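(* The following decision problem (relaxation validity) is co-NP-complete: given a directed graph $G$, a vertex $s$ of $G$, and a finite sequence $S$ of edges of $G$, decide whether $S$ contains, as a subsequence, every simple directed path of $G$ starting at $s$.
   Context: A sequence $S = (e_1,\dots,e_L)$ of edges contains a simple directed path $(v_1, \dots, v_k)$ if the edges $(v_1,v_2), (v_2,v_3), \dots, (v_{k-1},v_k)$ appear in $S$ as a subsequence in this order (not necessarily contiguously). Such a sequence $S$ is called a valid relaxation sequence when it contains every simple path of $G$ starting at $s$. *)

(* Defs.v *)
From mathcomp Require Import all_boot all_algebra.

Set Implicit Arguments.
Unset Strict Implicit.
Unset Printing Implicit Defensive.

Import GRing.Theory.

Definition word := seq bool.

Inductive move := Left | Stay | Right.

(* The tape alphabet consists of the blank [None], the two bits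
   [Some (inl b)] and finitely many auxiliary symbols [Some (inr a)].
   The number of tapes is [tm_tapes.+1].  The value of [tm_delta] at a
   halting state is never used. *)
Record TM := {
  tm_aux : finType;
  tm_state : finType;
  tm_tapes : nat;
  tm_start : tm_state;
  tm_halt : pred tm_state;
  tm_delta : tm_state -> {ffun 'I_tm_tapes.+1 -> option (bool + tm_aux)} ->
             tm_state * ('I_tm_tapes.+1 -> option (bool + tm_aux) * move)
}.

Definition symbol (M : TM) : Type := option (bool + tm_aux M).

(* A two-way infinite tape: the cells to the left of the head, nearest first,
   and the cells from the head rightwards; all cells not listed are blank. *)
Definition tape (M : TM) : Type := (seq (symbol M) * seq (symbol M))%type.

Definition tape_read M (t : tape M) : symbol M := head None t.2.

Definition tape_write M (a : symbol M) (t : tape M) : tape M :=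
  (t.1, a :: behead t.2).

Definition tape_move M (d : move) (t : tape M) : tape M :=
  match d with
  | Left => (behead t.1, head None t.1 :: t.2)
  | Stay => t
  | Right => (head None t.2 :: t.1, behead t.2)
  end.

Definition config (M : TM) : Type :=
  (tm_state M * ('I_(tm_tapes M).+1 -> tape M))%type.

Definition step M (c : config M) : config M :=
  if tm_halt c.1 then c else
  let: (q, act) := tm_delta c.1 [ffun i => tape_read (c.2 i)] in
  (q, fun i => tape_move (act i).2 (tape_write (act i).1 (c.2 i))).

(* The i-th input word is written on the i-th tape, with the head on its first
   letter; the remaining tapes are blank. *)
Definition init_config M (inputs : seq word) : config M :=
  (tm_start M,
   fun i : 'I_(tm_tapes M).+1 =>
     ([::], [seq Some (inl b) | b <- nth [::] inputs i])).

Fixpoint leading_bits M (s : seq (symbol M)) : word :=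
  if s is Some (inl b) :: s' then b :: leading_bits s' else [::].

(* The output is the word read on tape 0 from the head rightwards, up to the
   first symbol which is not a bit. *)
Definition output M (c : config M) : word := leading_bits (c.2 ord0).2.

(* [None] if M has not halted within t steps. *)
Definition run M (t : nat) (inputs : seq word) : option word :=
  let c := iter t (@step M) (init_config M inputs) in
  if tm_halt c.1 then Some (output c) else None.

Definition polytime_function (f : word -> word) : Prop :=
  exists (M : TM) (p : {poly nat}),
    forall x, run M p.[size x]%R [:: x] = Some (f x).

Definition polytime_relation (R : word -> word -> bool) : Prop :=
  exists (M : TM) (p : {poly nat}),
    forall x u, run M p.[(size x + size u)%N]%R [:: x; u] = Some [:: R x u].

Definition language := word -> Prop.

Definition NP (L : language) : Prop :=
  exists (R : word -> word -> bool) (q : {poly nat}),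
    polytime_relation R /\
    forall x, L x <-> exists u, size u <= q.[size x]%R /\ R x u.

Definition coNP (L : language) : Prop := NP (fun x => ~ L x).

Definition polytime_reducible (L L' : language) : Prop :=
  exists f, polytime_function f /\ forall x, L x <-> L' (f x).

Definition coNP_hard (L : language) : Prop :=
  forall L', coNP L' -> polytime_reducible L' L.

Definition coNP_complete (L : language) : Prop := coNP L /\ coNP_hard L.

(* S contains the directed path (v_1, ..., v_k), given as the list of its
   vertices. *)
Definition contains_path (V : eqType) (S : seq (V * V)) (vs : seq V) : bool :=
  subseq (zip vs (behead vs)) S.

Definition valid_relaxation_sequence (V : finType) (E : {set V * V}) (s : V)
    (S : seq (V * V)) : Prop :=
  forall vs : seq V,
    path (fun u v => (u, v) \in E) s vs -> uniq (s :: vs) ->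
    contains_path S (s :: vs).

Record instance := {
  order : nat;
  edges : {set 'I_order * 'I_order};
  source : 'I_order;
  relaxations : seq ('I_order * 'I_order);
  relaxations_edges : all (fun e => e \in edges) relaxations
}.

Definition encode_nat (n : nat) : word := rcons (nseq n true) false.

Definition encode_edge n (e : 'I_n * 'I_n) : word :=
  encode_nat e.1 ++ encode_nat e.2.

(* The number of vertices, the adjacency matrix row by row, the source, and
   the endpoints of the successive edges of the sequence.  Writing the vertices
   in unary changes the length only polynomially, since the matrix already has
   n ^ 2 bits. *)
Definition encode (I : instance) : word :=
  encode_nat (order I)
  ++ [seq (u, v) \in edges I | u <- enum 'I_(order I), v <- enum 'I_(order I)]
  ++ encode_nat (source I)
  ++ flatten [seq encode_edge e | e <- relaxations I].

Definition relaxation_validity : language := fun x =>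
  exists I : instance,
    x = encode I /\
    valid_relaxation_sequence (edges I) (source I) (relaxations I).

(* Main.v *)
(** Both halves rest on one class of functions: those given by expressions built
    from the constant 1, addition, truncated subtraction, bounded sums, and the
    lengths and letters of the input words.  Evaluating such an expression in
    unary on a multi-tape machine takes polynomial time, because bounded sums
    preserve polynomial bounds, and all the computations needed below can be
    phrased in this way.

    A certificate that a sequence is not valid is a simple path together with
    the trace of the greedy matching of its edges in the sequence.

    For hardness, a machine accepting a certificate is turned into a system of
    clauses on the cells of its computation tableau, and a system of clauses
    into a graph.  There a path visiting the terminals [0, 1, ..., top] in this
    order first chooses, for each variable, the chain of occurrences of its false
    literal, then, for each clause, an occurrence of a literal not met before,
    which exists iff the literal is true.  The edge sequence gives every other
    simple path one more chance to be matched than it needs, so that it misses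
    exactly the paths visiting all terminals in order. *)

From mathcomp Require Import all_boot all_algebra zify.
From Stdlib Require Import FunctionalExtensionality Classical.
Require Import Defs.

Set Implicit Arguments.
Unset Strict Implicit.
Unset Printing Implicit Defensive.

(** * Stack programs and their compilation to Turing machines *)

(** Expressions have no recursion, and this shapes both halves. Greedy matching is recursive, so its
    trace is part of the certificate and only its single steps are checked. In the reduction,
    vertices, facts and clauses are numbered in mixed radix, so that edges and occurrences of
    literals are decided by closed arithmetical formulas. Clauses may have any length: the graph
    only needs to know whether literal [l] occurs in clause [j], and no normal form with short
    clauses is built.

    The sequence must contain exponentially many paths and still omit certain ones. For this, edges
    into items are supplied in abundance, so that only the order of the terminals matters, while
    each list of edges into terminals is sorted by decreasing target and thus serves at most one
    edge of a path whose terminals increase.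

    The clauses of the tableau never say that a cell holds only one symbol. An assignment may make
    too many facts true; it suffices that it makes all facts of the run true, since the only
    condition on the output is that a fact be false. *)

Definition polyb (f : nat -> nat) : Prop :=
  exists c k, forall n, f n <= c * n.+1 ^ k.

Lemma polyb_const a : polyb (fun=> a).
Proof. by exists a, 0 => n; rewrite expn0 muln1. Qed.

Lemma polyb_id : polyb id.
Proof. by exists 1, 1 => n; rewrite mul1n expn1. Qed.

Lemma polybD f g : polyb f -> polyb g -> polyb (fun n => f n + g n).
Proof.
move=> [c [k Hf]] [d [l Hg]]; exists (c + d), (k + l) => n.
rewrite mulnDl; apply: leq_add; [apply: leq_trans (Hf n) _|apply: leq_trans (Hg n) _];
  by rewrite leq_mul2l leq_pexp2l ?orbT // ?leq_addr ?leq_addl.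
Qed.

Lemma polybM f g : polyb f -> polyb g -> polyb (fun n => f n * g n).
Proof.
move=> [c [k Hf]] [d [l Hg]]; exists (c * d), (k + l) => n.
by rewrite expnD mulnACA leq_mul.
Qed.

(** Monotonicity comes from the bound of [f] rather than from [f]; the factor [d.+1] absorbs the
    successor in [(g n).+1]. *)
Lemma polyb_comp f g : polyb f -> polyb g -> polyb (fun n => f (g n)).
Proof.
move=> [c [k Hf]] [d [l Hg]]; exists (c * d.+1 ^ k), (l * k) => n.
apply: leq_trans (Hf _) _; rewrite -mulnA leq_mul2l expnM -expnMn.
apply/orP; right; case: k {Hf} => // k; rewrite leq_exp2r //.
by apply: leq_ltn_trans (Hg n) _; rewrite mulSn -addn1 addnC leq_add2r expn_gt0.
Qed.

Lemma polyb_horner f : polyb f -> exists p : {poly nat}, forall n, f n <= p.[n]%R.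
Proof.
move=> [c [k Hf]]; exists (c%:P * ('X + 1%:P) ^+ k)%R => n.
rewrite !hornerE.
have -> : forall m : nat, (m ^+ k)%R = m ^ k by move=> m; elim: k {Hf} => // k IH; rewrite GRing.Theory.exprS IH expnS.
by apply: leq_trans (Hf n) _; rewrite -addn1.
Qed.
Lemma horner_nat_mono (p : {poly nat}) m n : m <= n -> p.[m]%R <= p.[n]%R.
Proof.
move=> mn; rewrite /horner; elim: (polyseq p) => //= a s IH.
by rewrite leq_add // leq_mul.
Qed.

Section Upd.
Context {T : Type}.
Definition upd (f : nat -> T) (k : nat) (v : T) : nat -> T :=
  fun j => if j == k then v else f j.
Lemma upd_id f k v : f k = v -> upd f k v = f.
Proof. by move=> <-; apply: functional_extensionality => j; rewrite /upd; case: eqP => // ->. Qed.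
Lemma updE f k v : upd f k v k = v. Proof. by rewrite /upd eqxx. Qed.
Lemma upd_ne f k v j : j != k -> upd f k v j = f j.
Proof. by rewrite /upd => /negPf ->. Qed.
End Upd.

Definition memory : Type := nat -> word.

(** Every test is destructive: [Case] and [Loop] pop the letter they inspect. The branches of [Case]
    are, in this order, for the empty stack, the letter [false] and the letter [true]; those of
    [Loop] are for [false] and [true]. *)
Inductive cmd :=
| Skip
| Push of nat & bool
| Seq of cmd & cmd
| Case of nat & cmd & cmd & cmd
| Loop of nat & cmd & cmd.

(** The counter is the exact number of transitions of the compiled machine: two for a push, one for
    a skip or a test, none for sequencing. Hence [compileP] preserves time without any conversion of
    bounds. *)
Inductive exec : cmd -> memory -> memory -> nat -> Prop :=
| ExSkip s : exec Skip s s 1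
| ExPush s i b : exec (Push i b) s (upd s i (b :: s i)) 2
| ExSeq c d s1 s2 s3 m n : exec c s1 s2 m -> exec d s2 s3 n -> exec (Seq c d) s1 s3 (m + n)
| ExCaseN i a c d s s' n : s i = [::] -> exec a s s' n -> exec (Case i a c d) s s' n.+1
| ExCaseB i a c d s s' n (b : bool) w : s i = b :: w ->
    exec (if b then d else c) (upd s i w) s' n -> exec (Case i a c d) s s' n.+1
| ExLoopN i c d s : s i = [::] -> exec (Loop i c d) s s 1
| ExLoopB i c d s s' s'' m n (b : bool) w : s i = b :: w ->
    exec (if b then d else c) (upd s i w) s' m -> exec (Loop i c d) s' s'' n ->
    exec (Loop i c d) s s'' (m + n).+1.

Fixpoint maxi (c : cmd) : nat :=
  match c with
  | Skip => 0
  | Push i _ => i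
  | Seq c d => maxn (maxi c) (maxi d)
  | Case i a c d => maxn i (maxn (maxi a) (maxn (maxi c) (maxi d)))
  | Loop i c d => maxn i (maxn (maxi c) (maxi d))
  end.

Notation sym := (option (bool + void)).

(* Tapes are indexed by a machine; this one serves for tapes without auxiliary
   symbols before any machine is built. *)
Definition void_TM : TM :=
  @Build_TM void unit 0 tt xpredT (fun q _ => (q, fun=> (None, Stay))).

Section Fragments.
Variable K : nat.

Notation reads := {ffun 'I_K.+1 -> sym}.
Notation tapes := ('I_K.+1 -> tape void_TM).
Notation twrite := (@tape_write void_TM).
Notation tmove := (@tape_move void_TM).
Notation tread := (@tape_read void_TM).
Notation act := ('I_K.+1 -> sym * move).

(* A machine without halting states: [None] as next state is the exit, so that
   fragments can be chained. *)
Record frag := Frag {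
  fstate :> finType;
  fstart : fstate;
  fdelta : fstate -> reads -> option fstate * act
}.

Definition apply_act (a : act) (T : tapes) : tapes :=
  fun i => tmove (a i).2 (twrite (a i).1 (T i)).

Definition reads_of (T : tapes) : reads := [ffun i => tread (T i)].

Inductive reach (F : frag) : nat -> F -> tapes -> tapes -> Prop :=
| ReachExit q T a : fdelta q (reads_of T) = (None, a) ->
    reach 1 q T (apply_act a T)
| ReachStep q q' T T' a n : fdelta q (reads_of T) = (Some q', a) ->
    reach n q' (apply_act a T) T' -> reach n.+1 q T T'.

Definition TM_of (F : frag) : TM :=
  @Build_TM void (option F) K (Some (fstart F)) (pred1 None)
    (fun q r => if q is Some q' then fdelta q' r else (None, fun i => (r i, Stay))).

Lemma reach_iter (F : frag) n (q : F) T T' : reach n q T T' ->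
  iter n (@step (TM_of F)) (Some q, T) = (None, T').
Proof.
move=> H; elim: H => {n q T T'} [q T a E|q q' T T' a n E _ IH].
  rewrite /= /step /=.
  by have -> : [ffun i => @tape_read (TM_of F) (T i)] = reads_of T by []; rewrite E.
rewrite iterSr /step /=.
have -> : [ffun i => @tape_read (TM_of F) (T i)] = reads_of T by []; rewrite E.
exact: IH.
Qed.

(** One simulation handles all compound commands: [h] places the states of [F] among those of [G],
    and [k] says where the exit of [F] leads, [None] being the exit of [G]. *)
Lemma reach_embed (F G : frag) (h : F -> G) (k : option G) :
  (forall q r, fdelta (h q) r =
     (if (fdelta q r).1 is Some q' then Some (h q') else k, (fdelta q r).2)) ->
  forall n q T T', reach n q T T' ->
  (k = None -> reach n (h q) T T') /\
  (forall q2 m T'', k = Some q2 -> reach m q2 T' T'' -> reach (n + m) (h q) T T'').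
Proof.
move=> E n q T T' H; elim: H => {n q T T'} [q T a D|q q' T T' a n D _ [IH1 IH2]]; split.
- by move=> k0; apply: ReachExit; rewrite E D /= k0.
- by move=> q2 m T'' k0 R; apply: ReachStep R; rewrite E D /= k0.
- by move=> k0; apply: ReachStep (IH1 k0); rewrite E D.
- by move=> q2 m T'' k0 R; apply: ReachStep (IH2 _ _ _ k0 R); rewrite E D.
Qed.

Definition idle (r : reads) : act := fun j => (r j, Stay).
Definition act_on (i : nat) (a : sym * move) (r : reads) : act :=
  fun j => if (j : nat) == i then a else (r j, Stay).

Definition fSkip : frag := @Frag unit tt (fun _ r => (None, idle r)).

(** A transition writes before it moves, so the first one writes back the symbol read and moves
    left, and the second one writes the new top. *)
Definition fPush (i : nat) (b : bool) : frag :=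
  @Frag bool false (fun q r =>
    if q then (None, act_on i (Some (inl b), Stay) r)
    else (Some true, act_on i (r (inord i), Left) r)).

Definition fmap_state (A B : finType) (h : A -> B) (k : option B)
    (p : option A * act) : option B * act :=
  (if p.1 is Some q then Some (h q) else k, p.2).

Definition fSeq (F G : frag) : frag :=
  @Frag (F + G)%type (inl (fstart F)) (fun q r =>
    match q with
    | inl q => fmap_state inl (Some (inr (fstart G))) (fdelta q r)
    | inr q => fmap_state inr None (fdelta q r)
    end).

Definition fCase (i : nat) (A C D : frag) : frag :=
  @Frag (option (A + (C + D)))%type None (fun q r =>
    match q with
    | None => match r (inord i) with
              | Some (inl b) =>
                (Some (Some (inr (if b then inr (fstart D) else inl (fstart C)))),
                 act_on i (None, Right) r)
              | _ => (Some (Some (inl (fstart A))), idle r)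
              end
    | Some (inl q) => fmap_state (fun q => Some (inl q)) None (fdelta q r)
    | Some (inr (inl q)) => fmap_state (fun q => Some (inr (inl q))) None (fdelta q r)
    | Some (inr (inr q)) => fmap_state (fun q => Some (inr (inr q))) None (fdelta q r)
    end).

Definition fLoop (i : nat) (C D : frag) : frag :=
  @Frag (option (C + D))%type None (fun q r =>
    match q with
    | None => match r (inord i) with
              | Some (inl b) =>
                (Some (Some (if b then inr (fstart D) else inl (fstart C))),
                 act_on i (None, Right) r)
              | _ => (None, idle r)
              end
    | Some (inl q) => fmap_state (fun q => Some (inl q)) (Some None) (fdelta q r)
    | Some (inr q) => fmap_state (fun q => Some (inr q)) (Some None) (fdelta q r)
    end).

Fixpoint compile (c : cmd) : frag :=
  match c with
  | Skip => fSkip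
  | Push i b => fPush i b
  | Seq c d => fSeq (compile c) (compile d)
  | Case i a c d => fCase i (compile a) (compile c) (compile d)
  | Loop i c d => fLoop i (compile c) (compile d)
  end.

(* The tape holds the stack [w], its top under the head. *)
Definition rep (t : tape void_TM) (w : word) : Prop :=
  (exists j, t.1 = nseq j None) /\
  (exists j, t.2 = [seq Some (inl b) | b <- w] ++ nseq j None).

Definition reps (T : tapes) (s : memory) : Prop := forall i, rep (T i) (s i).

Lemma rep_read t w : rep t w ->
  tread t = if w is b :: _ then Some (inl b) else None.
Proof. by case: t w => l r [|b w] [_ [[|j] /= E]]; rewrite /tape_read /= E. Qed.

(** Writing back a blank can turn an empty list of cells into a list of one blank; this is why [rep]
    leaves the number of trailing blanks open. *)
Lemma rep_idle t w : rep t w -> rep (twrite (tread t) t) w.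
Proof.
case: t => l r [[j /= ->] [k /= ->]]; split; first by exists j.
case: w => [|b w] /=; last by exists k.
by rewrite /tape_read /=; case: k => [|k]; [exists 1 | exists k.+1].
Qed.

Lemma rep_push t w b : rep t w ->
  rep (twrite (Some (inl b)) (tmove Left (twrite (tread t) t))) (b :: w).
Proof.
move/rep_idle; case: (twrite _ _) => l r [[j /= ->] [k /= ->]]; split.
  by exists j.-1; case: j.
by exists k.
Qed.

(** The popped letter is erased before the head moves on, which keeps everything to the left of the
    head blank. *)
Lemma rep_pop t w b : rep t (b :: w) -> rep (tmove Right (twrite None t)) w.
Proof.
case: t => l r [[j /= ->] [k /= ->]]; split; first by exists j.+1.
by exists k.
Qed.

Lemma reps_idle T s : reps T s -> reps (apply_act (idle (reads_of T)) T) s.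
Proof. by move=> H i; rewrite /apply_act /= ffunE; apply: rep_idle. Qed.

Lemma reps_act_on T s i a w : reps T s ->
  (forall j : 'I_K.+1, j = i :> nat ->
     rep (tmove a.2 (twrite a.1 (T j))) w) ->
  reps (apply_act (act_on i a (reads_of T)) T) (upd s i w).
Proof.
move=> H Hi j; rewrite /apply_act /act_on /upd.
by case: eqP => [/Hi //|_] /=; rewrite ffunE; apply: rep_idle.
Qed.

Lemma reads_ofE T s i : reps T s -> i <= K ->
  reads_of T (inord i) = if s i is b :: _ then Some (inl b) else None.
Proof. by move=> H iK; rewrite ffunE (rep_read (H _)) inordK. Qed.

Lemma compileP c s s' n : exec c s s' n -> maxi c <= K ->
  forall T, reps T s ->
  exists2 T', reach n (fstart (compile c)) T T' & reps T' s'.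
Proof.
move=> H; elim: H => {c s s' n} /=
  [s|s i b|c d s1 s2 s3 m n _ IH1 _ IH2|i a c d s s' n E _ IH
  |i a c d s s' n b w E _ IH|i c d s E|i c d s s' s'' m n b w E _ IH1 _ IH2].
- by move=> _ T H; exists (apply_act (idle (reads_of T)) T);
    [apply: ReachExit | apply: reps_idle].
- move=> iK T H.
  set T1 := apply_act (act_on i (reads_of T (inord i), Left) (reads_of T)) T.
  exists (apply_act (act_on i (Some (inl b), Stay) (reads_of T1)) T1).
    by apply: ReachStep; [reflexivity | apply: ReachExit].
  have -> : upd s i (b :: s i) = upd (upd s i (s i)) i (b :: s i).
    by apply: functional_extensionality => j; rewrite /upd; case: eqP.
  move=> j; rewrite /apply_act /act_on /upd; case: eqP => ji /=.
    rewrite /T1 /apply_act /act_on ji eqxx /= ffunE.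
    have -> : inord i = j by apply: val_inj; rewrite /= inordK.
    by rewrite -ji; apply: rep_push.
  rewrite ffunE; apply: rep_idle; rewrite /T1 /apply_act /act_on.
  by case: eqP => //= _; rewrite ffunE; apply: rep_idle.
- rewrite geq_max => /andP[cK dK] T H.
  have [T1 R1 H1] := IH1 cK T H; have [T2 R2 H2] := IH2 dK T1 H1.
  exists T2 => //.
  have [R3 _] := @reach_embed _ (fSeq (compile c) (compile d)) inr None (fun _ _ => erefl) _ _ _ _ R2.
  have [_] := @reach_embed _ (fSeq (compile c) (compile d)) inl _ (fun _ _ => erefl) _ _ _ _ R1.
  exact: (fun X => X _ _ _ erefl (R3 erefl)).
- rewrite !geq_max => /and4P[iK aK cK dK] T H.
  have [T1 R1 H1] := IH aK _ (reps_idle H).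
  exists T1 => //; apply: (@ReachStep (fCase i (compile a) (compile c) (compile d)) _ (Some (inl (fstart (compile a)))) _ _
    (idle (reads_of T))).
    by rewrite /= (reads_ofE H iK) E.
  have [R2 _] := @reach_embed _ (fCase i (compile a) (compile c) (compile d))
     (fun q => Some (inl q)) None (fun _ _ => erefl) _ _ _ _ R1.
  exact: R2.
- rewrite !geq_max => /and4P[iK aK cK dK] T H.
  have H0 : reps (apply_act (act_on i (None, Right) (reads_of T)) T) (upd s i w).
    by apply: (reps_act_on H) => j ji; apply: (@rep_pop _ _ b); rewrite -E -ji; apply: H.
  have bK : maxi (if b then d else c) <= K by case: (b).
  have [T1 R1 H1] := IH bK _ H0.
  exists T1 => //; apply: (@ReachStep (fCase i (compile a) (compile c) (compile d)) _ (Some (inr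
      (if b then inr (fstart (compile d)) else inl (fstart (compile c))))) _ _
    (act_on i (None, Right) (reads_of T))).
    by rewrite /= (reads_ofE H iK) E.
  case: b {E H0 bK IH} R1 => R1.
    have [R2 _] := @reach_embed _ (fCase i (compile a) (compile c) (compile d))
      (fun q => Some (inr (inr q))) None (fun _ _ => erefl) _ _ _ _ R1.
    exact: R2.
  have [R2 _] := @reach_embed _ (fCase i (compile a) (compile c) (compile d))
     (fun q => Some (inr (inl q))) None (fun _ _ => erefl) _ _ _ _ R1.
  exact: R2.
- rewrite !geq_max => /and3P[iK cK dK] T H.
  exists (apply_act (idle (reads_of T)) T); last exact: reps_idle.
  by apply: ReachExit; rewrite /= (reads_ofE H iK) E.
- move=> K0; have := K0; rewrite !geq_max => /and3P[iK cK dK] T H.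
  have H0 : reps (apply_act (act_on i (None, Right) (reads_of T)) T) (upd s i w).
    by apply: (reps_act_on H) => j ji; apply: (@rep_pop _ _ b); rewrite -E -ji; apply: H.
  have bK : maxi (if b then d else c) <= K by case: (b).
  have [T1 R1 H1] := IH1 bK _ H0.
  have [T2 R2 H2] := IH2 K0 _ H1.
  exists T2 => //; apply: (@ReachStep (fLoop i (compile c) (compile d)) _ (Some
      (if b then inr (fstart (compile d)) else inl (fstart (compile c)))) _ _
    (act_on i (None, Right) (reads_of T))).
    by rewrite /= (reads_ofE H iK) E.
  case: b {E H0 bK IH1} R1 => R1.
    have [_ R3] := @reach_embed _ (fLoop i (compile c) (compile d))
      (fun q => Some (inr q)) (Some None) (fun _ _ => erefl) _ _ _ _ R1.
    exact: R3 erefl R2.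
  have [_ R3] := @reach_embed _ (fLoop i (compile c) (compile d))
     (fun q => Some (inl q)) (Some None) (fun _ _ => erefl) _ _ _ _ R1.
  exact: R3 erefl R2.
Qed.

End Fragments.

Lemma leading_bits_rep (M : TM) (w : word) j :
  leading_bits ([seq Some (inl b) | b <- w] ++ nseq j None : seq (symbol M)) = w.
Proof. by elim: w => /= [|b w ->] //; case: j. Qed.

Lemma TM_of_cmd (c : cmd) : exists M : TM,
  forall inputs s n N, exec c (nth [::] inputs) s n -> n <= N ->
  run M N inputs = Some (s 0).
Proof.
exists (TM_of (compile (maxi c) c)) => inputs s n N H nN.
have H0 : reps (@init_config (TM_of (compile (maxi c) c)) inputs).2 (nth [::] inputs).
  by move=> i; split; exists 0; rewrite //= cats0.
have [T R H1] := compileP H (leqnn _) H0.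
rewrite /run -(subnK nN) iterD (reach_iter R).
set M := TM_of _.
have -> k : iter k (@step M) (None, T) = (None, T) by elim: k => //= k ->.
have [_ [j E]] := H1 ord0.
by congr Some; rewrite /output [X in leading_bits X]E; apply: leading_bits_rep.
Qed.

(** * Arithmetical expressions over the inputs *)

Definition exec_within c s s' N := exists2 n, exec c s s' n & n <= N.

Lemma exec_within_seq c d s1 s2 s3 M N B : exec_within c s1 s2 M -> exec_within d s2 s3 N -> M + N <= B ->
  exec_within (Seq c d) s1 s3 B.
Proof.
move=> [m Hm mM] [n Hn nN] B0; exists (m + n); first exact: ExSeq Hm Hn.
by apply: leq_trans B0; apply: leq_add.
Qed.

Lemma exec_within_push i b s s' N : s' = upd s i (b :: s i) -> 1 < N -> exec_within (Push i b) s s' N.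
Proof. by move=> -> N1; exists 2 => //; constructor. Qed.

Lemma exec_within_skip s s' N : s' = s -> 0 < N -> exec_within Skip s s' N.
Proof. by move=> -> N1; exists 1 => //; constructor. Qed.

Lemma exec_within_case i a c d s s' N :
  (match s i with
   | [::] => exec_within a s s' N
   | b :: w => exec_within (if b then d else c) (upd s i w) s' N
   end) -> exec_within (Case i a c d) s s' N.+1.
Proof.
case E: (s i) => [|b w] [n H nN]; exists n.+1 => //; first exact: ExCaseN.
exact: ExCaseB E H.
Qed.

(** [I v] is an invariant indexed by the word [v] still to be read from the stack [l]. A round costs
    at most [B] and one test; the last test finds the stack empty. *)
Lemma exec_within_loop (I : word -> memory) w B l c d s s' N :
  s = I w -> s' = I [::] -> (forall v, I v l = v) ->
  (forall w1 b v, w = w1 ++ b :: v ->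
     exec_within (if b then d else c) (upd (I (b :: v)) l v) (I v) B) ->
  size w * B.+1 + 1 <= N -> exec_within (Loop l c d) s s' N.
Proof.
move=> -> -> Il H sN.
suff [n Hn nN] : exec_within (Loop l c d) (I w) (I [::]) (size w * B.+1 + 1).
  by exists n => //; apply: leq_trans sN.
elim: w H {sN} => [|b w IH] H; first by exists 1 => //; constructor.
have [m Hm mB] := H [::] b w erefl.
have [|n Hn nN] := IH; first by move=> w1 b' v E; apply: (H (b :: w1)); rewrite E.
exists (m + n).+1; first exact: ExLoopB (Il _) Hm Hn.
by rewrite /= mulSn; lia.
Qed.

Ltac memeq := apply: functional_extensionality => ?; rewrite /upd;
  repeat (case: eqP => ?); subst; try congruence; try lia; auto.

Lemma exec_within_clear l s N : size (s l) * 2 + 1 <= N ->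
  exec_within (Loop l Skip Skip) s (upd s l [::]) N.
Proof.
move=> H; apply: (exec_within_loop (I := fun w => upd s l w) (w := s l) (B := 1)) => //.
- by rewrite upd_id.
- by move=> v; rewrite updE.
- by move=> w1 b v _; case: b; apply: exec_within_skip => //; memeq.
Qed.

(** Numbers and words share one kind of variable: the index of a sum is bound to a word of that many
    letters [true], and its value is read off by [Len]. *)
Inductive expr :=
| One
| Add of expr & expr
| Sub of expr & expr
| Len of nat
| Bit of nat & expr
| Sum of nat & expr & expr.

Fixpoint eval (e : expr) (v : nat -> word) : nat :=
  match e with
  | One => 1
  | Add a b => eval a v + eval b v
  | Sub a b => eval a v - eval b v
  | Len k => size (v k)
  | Bit k a => nth false (v k) (eval a v)
  | Sum k a b => \sum_(0 <= i < eval a v) eval b (upd v k (nseq i true))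
  end.

(* [r] assigns stacks to the variable names; the stacks from [s] on are free,
   and the value of [e], in unary, is pushed on the stack [t]. *)
Fixpoint code (e : expr) (r : nat -> nat) (s t : nat) : cmd :=
  match e with
  | One => Push t true
  | Add a b => Seq (code a r s t) (code b r s t)
  | Sub a b =>
      Seq (code a r s.+2 s) (Seq (code b r s.+2 s.+1)
       (Seq (Loop s.+1 (Case s Skip Skip Skip) (Case s Skip Skip Skip))
            (Loop s (Push t true) (Push t true))))
  | Len k =>
      Seq (Loop (r k) (Push s false) (Push s true))
          (Loop s (Seq (Push (r k) false) (Push t true))
                  (Seq (Push (r k) true) (Push t true)))
  | Bit k a =>
      let down := Case (r k) Skip (Push s.+1 false) (Push s.+1 true) in
      Seq (code a r s.+2 s) (Seq (Loop s down down)
       (Seq (Case (r k) Skip (Push (r k) false) (Seq (Push (r k) true) (Push t true)))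
            (Loop s.+1 (Push (r k) false) (Push (r k) true))))
  | Sum k a b =>
      let body := Seq (code b (upd r k s.+1) s.+2 t) (Push s.+1 true) in
      Seq (code a r s.+2 s) (Seq (Loop s body body) (Loop s.+1 Skip Skip))
  end.

(** Here [n] bounds the sizes of all words in the environment. Under a sum the index is a further
    word, shorter than [eval_bound a n], which explains the enlarged argument; polynomial bounds
    survive because they are closed under composition. *)
Fixpoint eval_bound (e : expr) (n : nat) : nat :=
  match e with
  | One => 1
  | Add a b => eval_bound a n + eval_bound b n
  | Sub a b => eval_bound a n
  | Len k => n
  | Bit k a => 1
  | Sum k a b => eval_bound a n * eval_bound b (n + eval_bound a n)
  end.

Fixpoint code_time (e : expr) (n : nat) : nat :=
  match e with
  | One => 2
  | Add a b => code_time a n + code_time b n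
  | Sub a b => code_time a n + code_time b n + (eval_bound b n * 3 + 1) + (eval_bound a n * 3 + 1)
  | Len k => (n * 3 + 1) + (n * 5 + 1)
  | Bit k a => code_time a n + (eval_bound a n * 4 + 1) + 5 + (n * 3 + 1)
  | Sum k a b => code_time a n + (eval_bound a n * (code_time b (n + eval_bound a n) + 2).+1 + 1) + (eval_bound a n * 2 + 1)
  end.

Lemma eval_bound_polyb e : polyb (eval_bound e).
Proof.
elim: e => /= [|a Ha b Hb|a Ha b Hb|k|k a Ha|k a Ha b Hb] //.
- exact: polyb_const.
- exact: polybD.
- exact: polyb_id.
- exact: polyb_const.
- apply: polybM => //; apply: (polyb_comp (g := fun n => n + eval_bound a n)) Hb _.
  by apply: polybD => //; apply: polyb_id.
Qed.

Lemma code_time_polyb e : polyb (code_time e).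
Proof.
have c := polyb_const; have i := polyb_id; have v := eval_bound_polyb.
elim: e => /= [|a Ha b Hb|a Ha b Hb|k|k a Ha|k a Ha b Hb] //;
  repeat first [done | exact: c | exact: v | exact: i | apply: polybD | apply: polybM].
have E f : polyb f -> polyb (fun n => (f n).+1).
  by move=> Hf; have := polybD Hf (c 1); under [fun n => _ + 1]functional_extensionality do rewrite addn1.
apply: (E); apply: polybD => //; apply: (polyb_comp (g := fun n => n + eval_bound a n)) Hb _.
by apply: polybD.
Qed.

Lemma eval_le_bound e v n : (forall k, size (v k) <= n) -> eval e v <= eval_bound e n.
Proof.
elim: e v n => /= [|a Ha b Hb|a Ha b Hb|k|k a Ha|k a Ha b Hb] v n H //.
- by apply: leq_add; auto.
- by apply: leq_trans (leq_subr _ _) _; apply: Ha.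
- by case: nth.
- have A := Ha _ _ H.
  apply: (@leq_trans (eval a v * eval_bound b (n + eval_bound a n))); last by rewrite leq_mul2r A orbT.
  rewrite -[X in X * _]subn0 -sum_nat_const_nat !big_nat; apply: leq_sum => i iA.
  by apply: Hb => j; rewrite /upd; case: eqP => _; rewrite ?size_nseq; have := H j; lia.
Qed.


Lemma eq_eval (e : expr) (v v' : nat -> word) : (forall k, v k = v' k) -> eval e v = eval e v'.
Proof. by move=> E; congr eval; apply: functional_extensionality. Qed.

(** The conditions on [r], [s] and [t] keep the inputs, the accumulator and the scratch stacks
    apart. Since [m'] differs from [m] on [t] only, the inputs are restored and the scratch stacks
    are empty again, so that code fragments can be run one after the other. *)
Lemma codeP e r s t m m' n :
  (forall k, r k < s) -> (forall k, r k <> t) -> t < s ->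
  (forall j, s <= j -> m j = [::]) -> (forall k, size (m (r k)) <= n) ->
  m' = upd m t (nseq (eval e (fun k => m (r k))) true ++ m t) ->
  exec_within (code e r s t) m m' (code_time e n).
Proof.
elim: e r s t m m' n => /= [|a Ha b Hb|a Ha b Hb|k|k a Ha|k a Ha b Hb]
  r s t m m' n Hr Ht ts Hm Hn -> {m'}.
- exact: exec_within_push.
- set v := fun k => m (r k).
  apply: (@exec_within_seq _ _ _ (upd m t (nseq (eval a v) true ++ m t))); last exact: leqnn.
    exact: Ha.
  have E k : upd m t (nseq (eval a v) true ++ m t) (r k) = m (r k).
    by rewrite upd_ne //; apply/eqP.
  apply: Hb => //; first by move=> j sj; rewrite upd_ne ?Hm //; lia.
    by move=> k; rewrite E.
  rewrite updE (eq_eval b E) -/v addnC nseqD -catA.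
  by memeq.
- set v := fun k => m (r k).
  set A := eval a v; set B := eval b v.
  set m1 := upd m s (nseq A true).
  set m2 := upd m1 s.+1 (nseq B true).
  have rs k : r k <> s /\ r k <> s.+1 by have := Hr k; lia.
  have E1 k : m1 (r k) = m (r k) by rewrite /m1 upd_ne //; apply/eqP; apply: (rs k).1.
  have av : A <= eval_bound a n := eval_le_bound a Hn; have bv : B <= eval_bound b n := eval_le_bound b Hn.
  apply: (@exec_within_seq _ _ _ m1 _ (code_time a n) (code_time b n + (eval_bound b n * 3 + 1 + (eval_bound a n * 3 + 1)))); last by lia.
    apply: Ha => //; try by move=> j; have := Hr j; have := Ht j; lia.
      by move=> j sj; apply: Hm; lia.
    by rewrite (Hm s) // cats0.
  apply: (@exec_within_seq _ _ _ m2 _ (code_time b n) (eval_bound b n * 3 + 1 + (eval_bound a n * 3 + 1))); last by [].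
  + apply: Hb => //; try by move=> j; have := Hr j; have := Ht j; lia.
    * by move=> j sj; rewrite /m1 upd_ne ?Hm //; lia.
    * by move=> j; rewrite E1.
    * by rewrite (eq_eval b E1) /m2 [m1 s.+1]upd_ne ?(Hm s.+1) ?cats0 //; lia.
  (* Each letter popped from the stack of [B] pops one from the stack of [A]; popping an empty stack
     does nothing, which gives the truncation. *)
  set m3 := upd m s (nseq (A - B) true).
  apply: (@exec_within_seq _ _ _ m3 _ (eval_bound b n * 3 + 1) (eval_bound a n * 3 + 1)); last by lia.
  + apply: (exec_within_loop (I := fun w => upd (upd m s (nseq (A - (B - size w)) true)) s.+1 w)
      (w := nseq B true) (B := 2)).
    * by rewrite size_nseq subnn subn0.
    * by rewrite /m3 /= subn0 -[in RHS](upd_id (Hm s.+1 (leqnSn _))); memeq.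
    * by move=> w; rewrite updE.
    * move=> w1 x w /(congr1 size); rewrite size_nseq size_cat /= => Bw.
      have -> : (if x then Case s Skip Skip Skip else Case s Skip Skip Skip) = Case s Skip Skip Skip by case: x.
      apply: exec_within_case.
      have -> : upd (upd (upd m s (nseq (A - (B - (size w).+1)) true)) s.+1 (x :: w)) s.+1 w s
         = nseq (A - (B - (size w).+1)) true by rewrite 2?upd_ne ?updE //; lia.
      case E : (A - (B - (size w).+1)) => [|d] /=.
        have -> : A - (B - size w) = 0 by lia.
        by apply: exec_within_skip => //; memeq.
      have -> : A - (B - size w) = d by lia.
      by apply: exec_within_skip => //; memeq.
    * by rewrite size_nseq; lia.
  + apply: (exec_within_loop (I := fun w => upd (upd m t (nseq ((A - B) - size w) true ++ m t)) s w)
      (w := nseq (A - B) true) (B := 2)).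
    * by rewrite size_nseq subnn /=; rewrite /m3; memeq.
    * by rewrite /= subn0 -[in LHS](upd_id (Hm s (leqnn _))); memeq.
    * by move=> w; rewrite updE.
    * move=> w1 x w /(congr1 size); rewrite size_nseq size_cat /= => Bw.
      have -> : (if x then Push t true else Push t true) = Push t true by case: x.
      apply: exec_within_push => //; have -> : A - B - size w = (A - B - (size w).+1).+1 by lia.
      by memeq.
    * by rewrite size_nseq; lia.
- have rs := Hr k; have rt := Ht k.
  set W := m (r k); have Wn : size W <= n := Hn k.
  (* The word is moved to [s], which reverses it, and moved back while each letter adds one unit on
     [t]. *)
  apply: (@exec_within_seq _ _ _ (upd (upd m (r k) [::]) s (rev W)) _ (n * 3 + 1) (n * 5 + 1)); last by [].
  + apply: (exec_within_loop (I := fun w => upd (upd m (r k) w) s (rev (take (size W - size w) W)))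
      (w := W) (B := 2)).
    * by rewrite subnn take0 /= -[in LHS](upd_id (Hm s (leqnn _))); memeq.
    * by rewrite /= subn0 take_size.
    * by move=> w; rewrite upd_ne ?updE //; lia.
    * move=> w1 x w E; rewrite E !size_cat /= addnK.
      have -> : size w1 + (size w).+1 - size w = (size w1).+1 by lia.
      rewrite take_cat ltnn subnn take0 cats0 take_cat ltnNge leqnSn /= subSnn /= take0 cats1 rev_rcons.
      by case: x {E}; apply: exec_within_push => //; memeq.
    * by lia.
  + apply: (exec_within_loop (I := fun w => upd (upd (upd m (r k) (drop (size w) W)) s w) t (nseq (size W - size w) true ++ m t))
      (w := rev W) (B := 4)).
    * by rewrite size_rev subnn drop_size /=; memeq.
    * by rewrite /= subn0 drop0 -[in LHS](upd_id (Hm s (leqnn _))) -/W; memeq.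
    * by move=> w; rewrite upd_ne ?updE //; lia.
    * move=> w1 x w /(congr1 rev); rewrite revK rev_cat rev_cons -cats1 => E.
      have E1 : drop (size w) W = x :: rev w1.
        by rewrite E -catA drop_size_cat ?size_rev.
      have E2 : drop (size (x :: w)) W = rev w1.
        by rewrite E drop_size_cat // size_cat size_rev addn1.
      have -> : (if x then Seq (Push (r k) true) (Push t true) else Seq (Push (r k) false) (Push t true)) =
         Seq (Push (r k) x) (Push t true) by case: (x).
      rewrite E1 E2; apply: (@exec_within_seq _ _ _ _ _ 2 2); [by apply: exec_within_push|apply: exec_within_push => //|by []].
      have := congr1 size E; rewrite !size_cat !size_rev /= => E3.
      have -> : size W - size w = (size W - (size w).+1).+1 by lia.
      by memeq.
    * by rewrite size_rev; lia.
- have rs := Hr k; have rt := Ht k.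
  set v := fun k => m (r k); set A := eval a v.
  set W := m (r k); have Wn : size W <= n := Hn k.
  have av : A <= eval_bound a n := eval_le_bound a Hn.
  set m1 := upd m s (nseq A true).
  apply: (@exec_within_seq _ _ _ m1 _ (code_time a n) ((eval_bound a n * 4 + 1) + (5 + (n * 3 + 1)))); last by lia.
    apply: Ha => //; try by move=> j; have := Hr j; have := Ht j; lia.
      by move=> j sj; apply: Hm; lia.
    by rewrite (Hm s) // cats0.
  (* The first [A] letters are parked in reverse on [s.+1], which brings the wanted letter to the
     top. If [A] is past the end the stack is then empty, and the default [false] contributes
     nothing. *)
  set m2 := upd (upd m (r k) (drop A W)) s.+1 (rev (take A W)).
  apply: (@exec_within_seq _ _ _ m2); last exact: leqnn.
    apply: (exec_within_loop (I := fun w => upd (upd (upd m (r k) (drop (A - size w) W)) s.+1 (rev (take (A - size w) W))) s w)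
      (w := nseq A true) (B := 3)).
    + rewrite size_nseq subnn drop0 take0 /= /m1 -[in LHS](upd_id (Hm s.+1 (leqnSn _))).
      by rewrite -[in LHS](upd_id (erefl W)); memeq.
    + by rewrite /= subn0 /m2 -[in LHS](upd_id (Hm s (leqnn _))); memeq.
    + by move=> w; rewrite updE.
    + move=> w1 x w /(congr1 size); rewrite size_nseq size_cat /= => Aw.
      have -> d : (if x then d else d) = d :> cmd by case: x.
      have -> : A - size w = (A - (size w).+1).+1 by lia.
      move: (A - (size w).+1) => j.
      apply: exec_within_case; rewrite upd_ne; last by lia.
      rewrite upd_ne; last by lia.
      rewrite upd_ne; last by lia.
      rewrite updE; case E : (drop j W) => [|y w'].
        have jW : size W <= j by rewrite leqNgt; apply/negP => /(drop_nth false); rewrite E.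
        apply: exec_within_skip => //; rewrite drop_oversize ?take_oversize ?(leq_trans jW) //.
        by memeq.
      have jW : j < size W by rewrite ltnNge; apply/negP => /drop_oversize; rewrite E.
      have := drop_nth false jW; rewrite E => -[-> ->].
      rewrite (take_nth false jW) rev_rcons.
      by case: nth; apply: exec_within_push => //; memeq.
    + by rewrite size_nseq; lia.
  set b := nth false W A.
  apply: (@exec_within_seq _ _ _ (upd m2 t (nseq b true ++ m t)) _ 5 (n * 3 + 1)); last by [].
    apply: exec_within_case; rewrite /m2 upd_ne; last by lia.
    rewrite updE; case E: (drop A W) => [|y w].
      have AW : size W <= A by rewrite leqNgt; apply/negP => /(drop_nth false); rewrite E.
      by apply: exec_within_skip; rewrite // /b nth_default //; memeq.
    have AW : A < size W by rewrite ltnNge; apply/negP => /drop_oversize; rewrite E.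
    have := drop_nth false AW; rewrite E => -[yE _].
    rewrite /b -yE; case: y {E yE}; last by apply: exec_within_push => //; memeq.
    apply: (@exec_within_seq _ _ _ _ _ 2 2); [by apply: exec_within_push|by apply: exec_within_push => //; memeq|by []].
  apply: (exec_within_loop (I := fun w => upd (upd (upd m (r k) (drop (size w) W)) s.+1 w) t (nseq b true ++ m t))
    (w := rev (take A W)) (B := 2)).
  + rewrite /m2 size_rev size_take; case: ltnP => // AW.
    by rewrite (drop_oversize AW) drop_size.
  + rewrite /= drop0 -[in LHS](upd_id (erefl W)) -[in LHS](upd_id (Hm s.+1 (leqnSn _))).
    by memeq.
  + by move=> w; rewrite upd_ne ?updE //; lia.
  + move=> w1 x w /(congr1 rev); rewrite revK rev_cat rev_cons -cats1 => E.
    have E0 := cat_take_drop A W; rewrite E in E0.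
    have E1 : drop (size w) W = x :: (rev w1 ++ drop A W).
      by rewrite -[LHS]/(drop (size w) W) -{1}E0 -!catA drop_size_cat ?size_rev.
    have E2 : drop (size (x :: w)) W = rev w1 ++ drop A W.
      by rewrite -{1}E0 -catA drop_size_cat // size_cat size_rev addn1.
    rewrite E1 E2.
    by case: x {E E0 E1 E2}; apply: exec_within_push => //; memeq.
  + by rewrite size_rev size_take; case: ltnP; lia.
- set v := fun k => m (r k); set A := eval a v.
  have av : A <= eval_bound a n := eval_le_bound a Hn.
  set m1 := upd m s (nseq A true).
  set M := n + eval_bound a n.
  apply: (@exec_within_seq _ _ _ m1 _ (code_time a n) ((eval_bound a n * (code_time b M + 2).+1 + 1) + (eval_bound a n * 2 + 1))); last by lia.
    apply: Ha => //; try by move=> j; have := Hr j; have := Ht j; lia.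
      by move=> j sj; apply: Hm; lia.
    by rewrite (Hm s) // cats0.
  set f := fun i => eval b (upd v k (nseq i true)).
  set m2 := upd (upd m t (nseq (\sum_(0 <= i < A) f i) true ++ m t)) s.+1 (nseq A true).
  apply: (@exec_within_seq _ _ _ m2); last exact: leqnn.
    apply: (exec_within_loop (I := fun w => upd (upd (upd m t (nseq (\sum_(0 <= i < A - size w) f i) true ++ m t)) s.+1 (nseq (A - size w) true)) s w)
      (w := nseq A true) (B := code_time b M + 2)).
    + rewrite size_nseq subnn /= big_geq //= /m1 -[in LHS](upd_id (Hm s.+1 (leqnSn _))).
      by memeq.
    + by rewrite /= subn0 /m2 -[in LHS](upd_id (Hm s (leqnn _))); memeq.
    + by move=> w; rewrite updE.
    + move=> w1 x w /(congr1 size); rewrite size_nseq size_cat /= => Aw.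
      have -> d : (if x then d else d) = d :> cmd by case: x.
      have -> : A - size w = (A - (size w).+1).+1 by lia.
      have : A - (size w).+1 < A by lia.
      move: (A - (size w).+1) => j jA.
      rewrite big_nat_recr //=.
      set m3 := upd (upd (upd m t (nseq (\sum_(0 <= i < j) f i) true ++ m t)) s.+1 (nseq j true)) s w.
      have -> : upd (upd (upd (upd m t (nseq (\sum_(0 <= i < j) f i) true ++ m t)) s.+1 (nseq j true)) s (x :: w)) s w = m3.
        by rewrite /m3; memeq.
      (* Redirecting the name [k] to the counter on [s.+1] is the compiled form of rebinding [k];
         the other names keep their stacks, which the loop leaves intact. *)
      have E : (fun q => m3 (upd r k s.+1 q)) = upd v k (nseq j true).
        apply: functional_extensionality => q; rewrite /m3 /upd.
        by case: (q =P k) => _; repeat case: eqP; have := Hr q; have := Ht q; rewrite // /v; lia.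
      apply: (@exec_within_seq _ _ _ (upd m3 t (nseq (f j) true ++ m3 t)) _ (code_time b M) 2); last by [].
        apply: Hb.
        - by move=> q; rewrite /upd; case: eqP => _; have := Hr q; lia.
        - by move=> q; rewrite /upd; case: eqP => _; have := Ht q; lia.
        - by lia.
        - by move=> q sq; rewrite /m3 !upd_ne ?Hm //; lia.
        - move=> q; rewrite (congr1 (fun g => g q) E) /upd; case: eqP => _.
            by rewrite size_nseq /M; lia.
          by have := Hn q; rewrite /M /v; lia.
        - by rewrite E.
      apply: exec_within_push => //.
      by rewrite addnC nseqD -catA /m3; memeq.
    + by rewrite size_nseq; apply: leq_add => //; rewrite leq_mul2r av orbT.
  have -> : upd m t (nseq (\sum_(0 <= i < A) f i) true ++ m t) = upd m2 s.+1 [::].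
    by rewrite /m2 -[in LHS](upd_id (Hm s.+1 (leqnSn _))); memeq.
  by apply: exec_within_clear; rewrite /m2 updE size_nseq; lia.
Qed.

(** * Expressions whose values are words *)

Inductive wexpr :=
| WBit of expr
| WCat of wexpr & wexpr
| WFor of nat & expr & wexpr.

Fixpoint weval (w : wexpr) (v : nat -> word) : word :=
  match w with
  | WBit e => [:: eval e v != 0]
  | WCat a b => weval a v ++ weval b v
  | WFor k e a => flatten [seq weval a (upd v k (nseq i true)) | i <- iota 0 (eval e v)]
  end.

(* The letters are pushed one by one on the stack [o], so the word is reversed. *)
Fixpoint wcode (w : wexpr) (r : nat -> nat) (s o : nat) : cmd :=
  match w with
  | WBit e =>
      let t := Seq (Push o true) (Loop s Skip Skip) in
      Seq (code e r s.+1 s) (Case s (Push o false) t t)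
  | WCat a b => Seq (wcode a r s o) (wcode b r s o)
  | WFor k e a =>
      let body := Seq (wcode a (upd r k s.+1) s.+2 o) (Push s.+1 true) in
      Seq (code e r s.+2 s) (Seq (Loop s body body) (Loop s.+1 Skip Skip))
  end.

Fixpoint wcode_time (w : wexpr) (n : nat) : nat :=
  match w with
  | WBit e => code_time e n + (eval_bound e n * 2 + 4)
  | WCat a b => wcode_time a n + wcode_time b n
  | WFor k e a => code_time e n + (eval_bound e n * (wcode_time a (n + eval_bound e n) + 2).+1 + 1) + (eval_bound e n * 2 + 1)
  end.

Lemma wcode_time_polyb w : polyb (wcode_time w).
Proof.
have c := polyb_const; have i := polyb_id; have v := eval_bound_polyb; have t := code_time_polyb.
elim: w => /= [e|a Ha b Hb|k e a Ha];
  repeat first [done | exact: c | exact: v | exact: t | exact: i | apply: polybD | apply: polybM].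
have E f : polyb f -> polyb (fun n => (f n).+1).
  by move=> Hf; have := polybD Hf (c 1); under [fun n => _ + 1]functional_extensionality do rewrite addn1.
apply: (E); apply: polybD => //; apply: (polyb_comp (g := fun n => n + eval_bound e n)) Ha _.
by apply: polybD.
Qed.

Lemma wcodeP w r s o m m' n :
  (forall k, r k < s) -> (forall k, r k <> o) -> o < s ->
  (forall j, s <= j -> m j = [::]) -> (forall k, size (m (r k)) <= n) ->
  m' = upd m o (rev (weval w (fun k => m (r k))) ++ m o) ->
  exec_within (wcode w r s o) m m' (wcode_time w n).
Proof.
elim: w r s m m' n => /= [e|a Ha b Hb|k e b Hb]
  r s m m' n Hr Ho os Hm Hn -> {m'}.
- set A := eval e _; have av : A <= eval_bound e n := eval_le_bound e Hn.
  apply: (@exec_within_seq _ _ _ (upd m s (nseq A true)) _ (code_time e n) (eval_bound e n * 2 + 4)); last by [].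
    apply: codeP => //; try by move=> j; have := Hr j; have := Ho j; lia.
      by move=> j sj; apply: Hm; lia.
    by rewrite (Hm s) // cats0.
  rewrite addnS; apply: exec_within_case; rewrite updE.
  have mE := upd_id (Hm s (leqnn _)).
  case: A av => [|A] av /=.
    by apply: exec_within_push; [rewrite -[in LHS]mE; memeq|lia].
  apply: (@exec_within_seq _ _ _ (upd (upd m s (nseq A true)) o (true :: m o)) _ 2 (eval_bound e n * 2 + 1)); last by lia.
    by apply: exec_within_push => //; memeq.
  have -> : upd m o (true :: m o) = upd (upd (upd m s (nseq A true)) o (true :: m o)) s [::].
    by rewrite -[in LHS]mE; memeq.
  by apply: exec_within_clear; rewrite upd_ne ?updE ?size_nseq; lia.
- set v := fun k => m (r k).
  apply: (@exec_within_seq _ _ _ (upd m o (rev (weval a v) ++ m o))); last exact: leqnn.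
    exact: Ha.
  have E k : upd m o (rev (weval a v) ++ m o) (r k) = m (r k).
    by rewrite upd_ne //; apply/eqP.
  apply: Hb => //; first by move=> j sj; rewrite upd_ne ?Hm //; lia.
    by move=> k; rewrite E.
  have -> : (fun k => upd m o (rev (weval a v) ++ m o) (r k)) = v.
    by apply: functional_extensionality => k; rewrite E.
  by rewrite updE rev_cat -catA; memeq.
- set v := fun k => m (r k); set A := eval e v.
  have av : A <= eval_bound e n := eval_le_bound e Hn.
  set m1 := upd m s (nseq A true).
  set M := n + eval_bound e n.
  apply: (@exec_within_seq _ _ _ m1 _ (code_time e n) ((eval_bound e n * (wcode_time b M + 2).+1 + 1) + (eval_bound e n * 2 + 1))); last by lia.
    apply: codeP => //; try by move=> j; have := Hr j; have := Ho j; lia.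
      by move=> j sj; apply: Hm; lia.
    by rewrite (Hm s) // cats0.
  set f := fun i => weval b (upd v k (nseq i true)).
  set g := fun j => rev (flatten [seq f i | i <- iota 0 j]).
  set m2 := upd (upd m o (g A ++ m o)) s.+1 (nseq A true).
  apply: (@exec_within_seq _ _ _ m2); last exact: leqnn.
    apply: (exec_within_loop (I := fun w => upd (upd (upd m o (g (A - size w) ++ m o)) s.+1 (nseq (A - size w) true)) s w)
      (w := nseq A true) (B := wcode_time b M + 2)).
    + rewrite size_nseq subnn /= /m1 -[in LHS](upd_id (Hm s.+1 (leqnSn _))).
      by memeq.
    + by rewrite /= subn0 /m2 -[in LHS](upd_id (Hm s (leqnn _))); memeq.
    + by move=> w; rewrite updE.
    + move=> w1 x w /(congr1 size); rewrite size_nseq size_cat /= => Aw.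
      have -> d : (if x then d else d) = d :> cmd by case: x.
      have -> : A - size w = (A - (size w).+1).+1 by lia.
      have : A - (size w).+1 < A by lia.
      move: (A - (size w).+1) => j jA.
      have -> : g j.+1 = rev (f j) ++ g j.
        by rewrite /g -addn1 iotaD map_cat flatten_cat rev_cat /= cats0.
      set m3 := upd (upd (upd m o (g j ++ m o)) s.+1 (nseq j true)) s w.
      have -> : upd (upd (upd (upd m o (g j ++ m o)) s.+1 (nseq j true)) s (x :: w)) s w = m3.
        by rewrite /m3; memeq.
      have E : (fun q => m3 (upd r k s.+1 q)) = upd v k (nseq j true).
        apply: functional_extensionality => q; rewrite /m3 /upd.
        by case: (q =P k) => _; repeat case: eqP; have := Hr q; have := Ho q; rewrite // /v; lia.
      apply: (@exec_within_seq _ _ _ (upd m3 o (rev (f j) ++ m3 o)) _ (wcode_time b M) 2); last by [].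
        apply: Hb.
        - by move=> q; rewrite /upd; case: eqP => _; have := Hr q; lia.
        - by move=> q; rewrite /upd; case: eqP => _; have := Ho q; lia.
        - by lia.
        - by move=> q sq; rewrite /m3 !upd_ne ?Hm //; lia.
        - move=> q; rewrite (congr1 (fun g => g q) E) /upd; case: eqP => _.
            by rewrite size_nseq /M; lia.
          by have := Hn q; rewrite /M /v; lia.
        - by rewrite E.
      apply: exec_within_push => //.
      by rewrite -catA /m3; memeq.
    + by rewrite size_nseq; apply: leq_add => //; rewrite leq_mul2r av orbT.
  have -> : upd m o (g A ++ m o) = upd m2 s.+1 [::].
    by rewrite /m2 -[in LHS](upd_id (Hm s.+1 (leqnSn _))); memeq.
  by apply: exec_within_clear; rewrite /m2 updE size_nseq; lia.
Qed.

(** All names but 0 denote the second word, so that the assignment of stacks is total and uses only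
    the stacks 0 and 1, as the freshness conditions of [codeP] and [wcodeP] require. *)
Definition input_env (x u : word) : nat -> word :=
  fun k => if k == 0 then x else u.

Definition input_stack (k : nat) : nat := (k != 0).

Lemma input_stackE x u : (fun k => nth [::] [:: x; u] (input_stack k)) = input_env x u.
Proof. by apply: functional_extensionality => -[|k]. Qed.

Lemma exec_within_flip l s N : l <> 0 -> s 0 = [::] -> size (s l) * 3 + 1 <= N ->
  exec_within (Loop l (Push 0 false) (Push 0 true)) s (upd (upd s 0 (rev (s l))) l [::]) N.
Proof.
move=> l0 s0 H; apply: (exec_within_loop (I := fun w => upd (upd s 0 (rev (take (size (s l) - size w) (s l)))) l w)
  (w := s l) (B := 2)) => //.
- rewrite subnn take0 -[in LHS](upd_id (erefl (s l))) -[in LHS](upd_id s0).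
  by memeq.
- by rewrite /= subn0 take_size.
- by move=> v; rewrite updE.
- move=> w1 x w E; rewrite E !size_cat /= addnK.
  have -> : size w1 + (size w).+1 - size w = (size w1).+1 by lia.
  have -> : take (size w1).+1 (w1 ++ x :: w) = rcons w1 x.
    by rewrite -cat_rcons take_size_cat ?size_rcons.
  rewrite take_size_cat // rev_rcons.
  by case: x {E}; apply: exec_within_push => //; memeq.
Qed.

(** A push is the only way to lengthen a stack. The length of an output is thus bounded by the time
    spent on it, and word expressions need no size bound of their own. *)
Lemma exec_size c s s' n k : exec c s s' n -> size (s' k) <= size (s k) + n.
Proof.
have U (s1 : memory) i v j : size v <= (size (s1 i)).+1 -> size (upd s1 i v j) <= (size (s1 j)).+1.
  by rewrite /upd; case: eqP => // ->.
move=> H; elim: H => {c s s' n} /=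
  [s|s i b|c d s1 s2 s3 m n _ IH1 _ IH2|i a c d s s' n E _ IH
  |i a c d s s' n b w E _ IH|i c d s E|i c d s s' s'' m n b w E _ IH1 _ IH2]; try lia.
- by apply: leq_trans (U s i (b :: s i) k _) _; rewrite /= ?addn2.
- by apply: leq_trans IH _; rewrite addnS -addSn leq_add2r; apply: U; rewrite E /=; lia.
- apply: leq_trans IH2 _; rewrite -addSn addnA leq_add2r; apply: leq_trans IH1 _.
  by rewrite addnS -addSn leq_add2r; apply: U; rewrite E /=; lia.
Qed.

Lemma polytime_function_weval (w : wexpr) f :
  (forall x, weval w (input_env x [::]) = f x) -> polytime_function f.
Proof.
move=> H.
have [p Hp] : exists p : {poly nat}, forall n, wcode_time w n + (n * 2 + 1) + (wcode_time w n * 3 + 1) <= p.[n]%R.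
  apply: polyb_horner.
  by repeat first [exact: polyb_id | exact: polyb_const | exact: wcode_time_polyb | apply: polybD | apply: polybM].
(* Stack 2 receives the reversed result, which is turned over onto stack 0, the output tape, once
   the input there has been cleared. *)
have [M HM] := TM_of_cmd (Seq (wcode w input_stack 3 2)
  (Seq (Loop 0 Skip Skip) (Loop 2 (Push 0 false) (Push 0 true)))).
exists M, p => x; set m := nth [::] [:: x].
have mE : (fun k => m (input_stack k)) = input_env x [::].
  by rewrite -input_stackE; apply: functional_extensionality => -[|k].
have P : exec_within (wcode w input_stack 3 2) m (upd m 2 (rev (f x))) (wcode_time w (size x)).
  apply: wcodeP; [by case|by case|by []|by case=> [|[|[|j]]]| |].
  - by move=> k; rewrite (congr1 (fun g => g k) mE); case: k.
  - by rewrite mE H (_ : m 2 = [::]) ?cats0.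
have sz : size (f x) <= wcode_time w (size x).
  by have [n Hn] := P; have := exec_size 2 Hn; rewrite updE size_rev /=; lia.
suff [n Hn nN] : exec_within (Seq (wcode w input_stack 3 2)
  (Seq (Loop 0 Skip Skip) (Loop 2 (Push 0 false) (Push 0 true)))) m
  (upd (upd (upd (upd m 2 (rev (f x))) 0 [::]) 0 (f x)) 2 [::])
  (wcode_time w (size x) + (size x * 2 + 1 + (wcode_time w (size x) * 3 + 1))).
  have B := Hp (size x); rewrite -addnA in B.
  by rewrite (HM _ _ _ _ Hn (leq_trans nN B)) upd_ne // updE.
apply: exec_within_seq P _ (leqnn _).
apply: (@exec_within_seq _ _ _ (upd (upd m 2 (rev (f x))) 0 [::])); last exact: leqnn.
  by apply: exec_within_clear; rewrite upd_ne.
have := @exec_within_flip 2 (upd (upd m 2 (rev (f x))) 0 [::]) (wcode_time w (size x) * 3 + 1).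
rewrite updE upd_ne // updE revK size_rev; apply => //.
by rewrite leq_add2r leq_mul2r sz orbT.
Qed.

Lemma polytime_relation_eval (e : expr) (R : word -> word -> bool) :
  (forall x u, eval e (input_env x u) = R x u) -> polytime_relation R.
Proof.
move=> H.
have [p Hp] : exists p : {poly nat}, forall n, code_time e n + (n * 2 + 1) + 3 <= p.[n]%R.
  apply: polyb_horner.
  by repeat first [exact: polyb_id | exact: polyb_const | exact: code_time_polyb | apply: polybD | apply: polybM].
have [M HM] := TM_of_cmd (Seq (code e input_stack 3 2)
  (Seq (Loop 0 Skip Skip) (Case 2 (Push 0 false) (Push 0 true) (Push 0 true)))).
exists M, p => x u; set m := nth [::] [:: x; u].
have mE : (fun k => m (input_stack k)) = input_env x u by exact: input_stackE.
have P : exec_within (code e input_stack 3 2) m (upd m 2 (nseq (R x u) true)) (code_time e (size x + size u)).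
  apply: codeP; [by case|by case|by []| | |].
  - by case=> [|[|[|j]]] //; rewrite /m /= nth_nil.
  - by move=> k; rewrite (congr1 (fun g => g k) mE); case: k => [|k] /=; rewrite ?leq_addr ?leq_addl.
  - by rewrite mE H (_ : m 2 = [::]) ?cats0.
suff [n Hn nN] : exec_within (Seq (code e input_stack 3 2)
  (Seq (Loop 0 Skip Skip) (Case 2 (Push 0 false) (Push 0 true) (Push 0 true)))) m
  (upd (upd (upd m 2 [::]) 0 [::]) 0 [:: R x u])
  (code_time e (size x + size u) + ((size x + size u) * 2 + 1 + 3)).
  have B := Hp (size x + size u); rewrite -addnA in B.
  by rewrite (HM _ _ _ _ Hn (leq_trans nN B)) updE.
apply: exec_within_seq P _ (leqnn _).
apply: (@exec_within_seq _ _ _ (upd (upd m 2 (nseq (R x u) true)) 0 [::])); last exact: leqnn.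
  by apply: exec_within_clear; rewrite upd_ne // leq_add2r leq_mul2r leq_addr orbT.
apply: exec_within_case; rewrite upd_ne // updE.
by case: (R x u) => /=; apply: exec_within_push => //; memeq.
Qed.

(** * Functions definable by expressions *)

(* The two input words and the values of [d] bound variables; the [j]-th variable
   has the name [j + 2] and is stored in unary. *)
Fixpoint ctx (d : nat) : Type := if d is d'.+1 then (ctx d' * nat)%type else (word * word)%type.

Fixpoint agrees (d : nat) (v : nat -> word) : ctx d -> Prop :=
  match d return ctx d -> Prop with
  | 0 => fun g => v 0 = g.1 /\ v 1 = g.2
  | d'.+1 => fun g => agrees v g.1 /\ v d'.+2 = nseq g.2 true
  end.

Lemma agrees_upd d v (g : ctx d) k w : d.+1 < k -> agrees v g -> agrees (upd v k w) g.
Proof.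
elim: d g => [|d IH] /= g dk [H1 H2]; split; rewrite ?upd_ne //; try lia.
by apply: IH => //; lia.
Qed.

Definition definable d (F : ctx d -> nat) : Prop :=
  exists e, forall v g, agrees v g -> eval e v = F g.
Definition bdefinable d (P : ctx d -> bool) : Prop := definable (fun g => nat_of_bool (P g)).
Definition wdefinable d (F : ctx d -> word) : Prop :=
  exists w, forall v g, agrees v g -> weval w v = F g.
Definition input_word d (W : ctx d -> word) : Prop :=
  exists k, forall v g, agrees v g -> v k = W g.

Section Closure.
Variable d : nat.
Implicit Types (F G : ctx d -> nat) (P Q : ctx d -> bool) (W : ctx d -> word).

Lemma definable_ext F G : (forall g, F g = G g) -> definable F -> definable G.
Proof. by move=> E [e He]; exists e => v g /He ->. Qed.

Lemma definable_wk F : definable F -> definable (d := d.+1) (fun g => F g.1).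
Proof. by move=> [e He]; exists e => v g [/He]. Qed.

Lemma bdefinable_wk P : bdefinable P -> bdefinable (d := d.+1) (fun g => P g.1).
Proof. exact: definable_wk. Qed.

Lemma input_word_wk W : input_word W -> input_word (d := d.+1) (fun g => W g.1).
Proof. by move=> [e He]; exists e => v g [/He]. Qed.

Lemma definable_var : definable (d := d.+1) (fun g => g.2).
Proof. by exists (Len d.+2) => v g [_ /= ->]; rewrite size_nseq. Qed.

Lemma definable_add F G : definable F -> definable G -> definable (fun g => F g + G g).
Proof. by move=> [a Ha] [b Hb]; exists (Add a b) => v g H /=; rewrite (Ha _ _ H) (Hb _ _ H). Qed.

Lemma definable_sub F G : definable F -> definable G -> definable (fun g => F g - G g).
Proof. by move=> [a Ha] [b Hb]; exists (Sub a b) => v g H /=; rewrite (Ha _ _ H) (Hb _ _ H). Qed.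

Lemma definable_const n : definable (fun _ : ctx d => n).
Proof.
elim: n => [|n [e He]]; first by exists (Sub One One).
by exists (Add One e) => v g /He /= ->.
Qed.

Lemma definable_succ F : definable F -> definable (fun g => (F g).+1).
Proof.
move=> HF; apply: definable_ext (definable_add HF (definable_const 1)) => g.
by rewrite addn1.
Qed.

Lemma definable_pred F : definable F -> definable (fun g => (F g).-1).
Proof.
move=> HF; apply: definable_ext (definable_sub HF (definable_const 1)) => g.
by rewrite subn1.
Qed.

Lemma definable_sum F (G : ctx d -> nat -> nat) : definable F -> definable (d := d.+1) (fun g => G g.1 g.2) ->
  definable (fun g => \sum_(0 <= i < F g) G g i).
Proof.
move=> [a Ha] [b Hb]; exists (Sum d.+2 a b) => v g H /=.
rewrite (Ha _ _ H); apply: eq_bigr => i _.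
by apply: (Hb _ (g, i)); split; rewrite ?updE //; apply: agrees_upd.
Qed.

Lemma definable_mul F G : definable F -> definable G -> definable (fun g => F g * G g).
Proof.
move=> HF HG.
apply: definable_ext (definable_sum (G := fun g _ => G g) HF (definable_wk HG)) => g.
by rewrite sum_nat_const_nat subn0.
Qed.

Lemma definable_size W : input_word W -> definable (fun g => size (W g)).
Proof. by move=> [k Hk]; exists (Len k) => v g /= /Hk ->. Qed.

Lemma bdefinable_nth W F : input_word W -> definable F -> bdefinable (fun g => nth false (W g) (F g)).
Proof. by move=> [k Hk] [e He]; exists (Bit k e) => v g H /=; rewrite (Hk _ _ H) (He _ _ H). Qed.

Lemma definable_bool P : bdefinable P -> definable (fun g => P g : nat).
Proof. by []. Qed.

Lemma bdefinable_ext P Q : (forall g, P g = Q g) -> bdefinable P -> bdefinable Q.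
Proof. by move=> E; apply: definable_ext => g; rewrite E. Qed.

Lemma bdefinable_const b : bdefinable (fun _ : ctx d => b).
Proof. exact: definable_const. Qed.

Lemma bdefinable_not P : bdefinable P -> bdefinable (fun g => ~~ P g).
Proof.
move=> H; apply: definable_ext (definable_sub (definable_const 1) H) => g.
by case: (P g).
Qed.

Lemma bdefinable_and P Q : bdefinable P -> bdefinable Q -> bdefinable (fun g => P g && Q g).
Proof.
move=> H1 H2; apply: definable_ext (definable_mul H1 H2) => g.
by case: (P g); case: (Q g).
Qed.

Lemma bdefinable_or P Q : bdefinable P -> bdefinable Q -> bdefinable (fun g => P g || Q g).
Proof.
move=> H1 H2; apply: bdefinable_ext (bdefinable_not (bdefinable_and (bdefinable_not H1) (bdefinable_not H2))) => g.
by case: (P g); case: (Q g).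
Qed.

Lemma bdefinable_pos F : definable F -> bdefinable (fun g => 0 < F g).
Proof.
move=> H; apply: definable_ext (definable_sub (definable_const 1) (definable_sub (definable_const 1) H)) => g.
by case: (F g).
Qed.

Lemma bdefinable_leq F G : definable F -> definable G -> bdefinable (fun g => F g <= G g).
Proof.
move=> H1 H2; apply: bdefinable_ext (bdefinable_not (bdefinable_pos (definable_sub H1 H2))) => g.
by rewrite subn_gt0 -leqNgt.
Qed.

Lemma bdefinable_eq F G : definable F -> definable G -> bdefinable (fun g => F g == G g).
Proof.
move=> H1 H2; apply: bdefinable_ext (bdefinable_and (bdefinable_leq H1 H2) (bdefinable_leq H2 H1)) => g.
by rewrite eqn_leq.
Qed.

Lemma bdefinable_eqb P Q : bdefinable P -> bdefinable Q -> bdefinable (fun g => P g == Q g).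
Proof.
move=> H1 H2; apply: bdefinable_ext (bdefinable_eq H1 H2) => g.
by case: (P g); case: (Q g).
Qed.

Lemma definable_if P F G : bdefinable P -> definable F -> definable G -> definable (fun g => if P g then F g else G g).
Proof.
move=> H1 H2 H3; apply: definable_ext (definable_add (definable_mul H1 H2) (definable_mul (bdefinable_not H1) H3)) => g.
by case: (P g); rewrite ?mul1n ?mul0n ?addn0.
Qed.

Lemma bdefinable_if P Q1 Q2 : bdefinable P -> bdefinable Q1 -> bdefinable Q2 -> bdefinable (fun g => if P g then Q1 g else Q2 g).
Proof.
by move=> H1 H2 H3; apply: definable_ext (definable_if H1 H2 H3) => g; case: (P g).
Qed.

End Closure.

Section Quantifiers.
Variable d : nat.
Implicit Types (F G : ctx d -> nat).

(** A bounded conjunction says that the number of failures, a bounded sum, is zero. *)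
Lemma bdefinable_all F (P : ctx d -> nat -> bool) : definable F ->
  bdefinable (d := d.+1) (fun g => P g.1 g.2) -> bdefinable (fun g => all (P g) (iota 0 (F g))).
Proof.
move=> H1 H2; apply: bdefinable_ext (bdefinable_not (bdefinable_pos
  (definable_sum (G := fun g i => nat_of_bool (~~ P g i)) H1 (bdefinable_not H2)))) => g.
rewrite /index_iota subn0 -eqn0Ngt; elim: iota => [|i s IH]; first by rewrite big_nil.
by rewrite big_cons /= -IH addn_eq0; case: (P g i).
Qed.

(** The type does not depend on the input, so the quantifier unfolds into a disjunction of fixed
    length; it will range over data of a fixed machine. *)
Lemma bdefinable_exists (T : finType) (P : T -> ctx d -> bool) :
  (forall a, bdefinable (P a)) -> bdefinable (fun g => [exists a, P a g]).
Proof.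
move=> H.
have {}H s : bdefinable (fun g => has (P^~ g) s).
  elim: s => [|a s IH] /=; first exact: bdefinable_const.
  exact: bdefinable_or.
apply: bdefinable_ext (H (enum T)) => g.
apply/hasP/existsP => [[a _ Ha]|[a Ha]]; exists a => //.
by rewrite mem_enum.
Qed.

Lemma sum_ltn n m : \sum_(0 <= i < n) (i < m) = minn n m.
Proof.
elim: n => [|n IH]; first by rewrite big_geq ?min0n.
by rewrite big_nat_recr //= IH; lia.
Qed.

End Quantifiers.

Lemma definable_horner d (p : {poly nat}) (F : ctx d -> nat) : definable F -> definable (fun g => p.[F g]%R).
Proof.
move=> HF; rewrite /horner; elim: (polyseq p) => [|a s IH] /=; first exact: definable_const.
exact: definable_add (definable_mul IH HF) (definable_const _ _).
Qed.

Lemma input_word_fst : input_word (fun g : ctx 0 => g.1).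
Proof. by exists 0 => v g []. Qed.

Lemma input_word_snd : input_word (fun g : ctx 0 => g.2).
Proof. by exists 1 => v g []. Qed.

Lemma definable_var1 d : definable (d := d.+2) (fun g => g.1.2).
Proof. exact: definable_wk (@definable_var d). Qed.
Lemma definable_var2 d : definable (d := d.+3) (fun g => g.1.1.2).
Proof. exact: definable_wk (@definable_var1 d). Qed.
Ltac comp_leaf := first
  [ assumption
  | exact: definable_const | exact: bdefinable_const
  | exact: definable_var | exact: definable_var1 | exact: definable_var2
  | exact: input_word_fst | exact: input_word_snd
  | progress simple apply definable_wk; comp_leaf
  | progress simple apply bdefinable_wk; comp_leaf
  | progress simple apply input_word_wk; comp_leaf ].

Ltac comp_step := lazymatch goal with
  | |- @definable _ (fun _ => _ + _) => apply definable_add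
  | |- @definable _ (fun _ => _ - _) => apply definable_sub
  | |- @definable _ (fun _ => _ * _) => apply definable_mul
  | |- @definable _ (fun _ => S _) => apply definable_succ
  | |- @definable _ (fun _ => Nat.pred _) => apply definable_pred
  | |- @definable _ (fun _ => size _) => apply definable_size
  | |- @definable _ (fun _ => if _ then _ else _) => apply definable_if
  | |- @definable _ (fun _ => bigop _ _ _) => apply definable_sum; cbn beta
  | |- @definable _ (fun _ => nat_of_bool _) => apply definable_bool
  | |- @bdefinable _ (fun _ => ~~ _) => apply bdefinable_not
  | |- @bdefinable _ (fun _ => _ && _) => apply bdefinable_and
  | |- @bdefinable _ (fun _ => _ || _) => apply bdefinable_or
  | |- @bdefinable _ (fun _ => _ <= _) => apply bdefinable_leq
  | |- @bdefinable _ (fun _ => eq_op _ _) => first [apply bdefinable_eq | apply bdefinable_eqb]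
  | |- @bdefinable _ (fun _ => if _ then _ else _) => apply bdefinable_if
  | |- @bdefinable _ (fun _ => nth _ _ _) => apply bdefinable_nth
  | |- @bdefinable _ (fun _ => all _ _) => apply bdefinable_all; cbn beta
  | |- @bdefinable _ (fun _ => [exists a, _]) => apply bdefinable_exists; cbn beta
  end.

Ltac comp_auto := repeat first [comp_leaf | comp_step].

Lemma definable_div d (F G : ctx d -> nat) : definable F -> definable G -> definable (fun g => F g %/ G g).
Proof.
move=> HF HG.
(* The quotient is the number of positive multiples of the divisor up to the dividend; the guard
   yields 0 for the divisor 0, as [divn] does. *)
apply: (@definable_ext _ (fun g => \sum_(0 <= i < F g) ((0 < G g) && (i.+1 * G g <= F g) : nat))) => [g|].
  case G0: (0 < G g).
    under eq_bigr => i _ do rewrite /= -leq_divRL //.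
    by rewrite sum_ltn; apply/minn_idPr; apply: leq_div.
  rewrite big1 => [|i _]; last by rewrite /=.
  by move: G0; rewrite lt0n => /negbFE/eqP ->; rewrite divn0.
comp_auto.
Qed.

Lemma definable_mod d (F G : ctx d -> nat) : definable F -> definable G -> definable (fun g => F g %% G g).
Proof.
move=> HF HG.
apply: (@definable_ext _ (fun g => F g - F g %/ G g * G g)) => [g|].
  by rewrite {1}(divn_eq (F g) (G g)) addnC addnK.
by apply: definable_sub => //; apply: definable_mul => //; apply: definable_div.
Qed.

Section Words.
Variable d : nat.
Implicit Types (F : ctx d -> nat) (P : ctx d -> bool) (U W : ctx d -> word).

Lemma wdefinable_ext U W : (forall g, U g = W g) -> wdefinable U -> wdefinable W.
Proof. by move=> E [e He]; exists e => v g /He ->. Qed.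

Lemma wdefinable_bit P : bdefinable P -> wdefinable (fun g => [:: P g]).
Proof. by move=> [e He]; exists (WBit e) => v g /He /= ->; case: (P g). Qed.

Lemma wdefinable_cat U W : wdefinable U -> wdefinable W -> wdefinable (fun g => U g ++ W g).
Proof. by move=> [a Ha] [b Hb]; exists (WCat a b) => v g H /=; rewrite (Ha _ _ H) (Hb _ _ H). Qed.

Lemma wdefinable_for F (W : ctx d -> nat -> word) : definable F ->
  wdefinable (d := d.+1) (fun g => W g.1 g.2) ->
  wdefinable (fun g => flatten [seq W g i | i <- iota 0 (F g)]).
Proof.
move=> [a Ha] [b Hb]; exists (WFor d.+2 a b) => v g H /=.
rewrite (Ha _ _ H); congr flatten; apply: eq_map => i.
by apply: (Hb _ (g, i)); split; rewrite ?updE //; apply: agrees_upd.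
Qed.

Lemma wdefinable_wk W : wdefinable W -> wdefinable (d := d.+1) (fun g => W g.1).
Proof. by move=> [e He]; exists e => v g [/He]. Qed.

(** A conditional word is a loop with [P g] rounds, that is, one or none. *)
Lemma wdefinable_if P W : bdefinable P -> wdefinable W -> wdefinable (fun g => if P g then W g else [::]).
Proof.
move=> HP HW; apply: wdefinable_ext (wdefinable_for (W := fun g _ => W g) (definable_bool HP) (wdefinable_wk HW)) => g.
by case: (P g); rewrite //= cats0.
Qed.
End Words.

Lemma wdefinable_encode_nat d (F : ctx d -> nat) : definable F -> wdefinable (fun g => encode_nat (F g)).
Proof.
move=> HF; apply: (@wdefinable_ext _ (fun g => flatten [seq [:: true] | i <- iota 0 (F g)] ++ [:: false])) => [g|].
  by rewrite /encode_nat -cats1; congr cat; elim: (F g) 0 => //= n IH m; rewrite IH.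
by apply: wdefinable_cat; [apply: wdefinable_for => //|]; apply: wdefinable_bit; apply: bdefinable_const.
Qed.

Lemma polytime_function_wdefinable (f : word -> word) :
  wdefinable (fun g : ctx 0 => f g.1) -> polytime_function f.
Proof.
by move=> [w Hw]; apply: (@polytime_function_weval w) => x; apply: (Hw _ (x, [::])).
Qed.

Lemma polytime_relation_bdefinable (R : word -> word -> bool) :
  bdefinable (fun g : ctx 0 => R g.1 g.2) -> polytime_relation R.
Proof.
by move=> [e He]; apply: (@polytime_relation_eval e) => x u; apply: (He _ (x, u)).
Qed.

(** * Instances over the natural numbers *)

(** Vertices become plain numbers here: the decoder and the reduction then avoid ordinal types whose
    bound varies with the input. *)
Definition natencode (n : nat) (E : rel nat) (s : nat) (S : seq (nat * nat)) : word :=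
  encode_nat n ++ flatten [seq [seq E u v | v <- iota 0 n] | u <- iota 0 n] ++
  encode_nat s ++ flatten [seq encode_nat e.1 ++ encode_nat e.2 | e <- S].

Definition natvalid (E : rel nat) (s : nat) (S : seq (nat * nat)) : Prop :=
  forall vs, path E s vs -> uniq (s :: vs) -> subseq (zip (s :: vs) vs) S.

Definition natwf (n : nat) (E : rel nat) (s : nat) (S : seq (nat * nat)) : Prop :=
  [/\ s < n, forall u v, E u v -> u < n /\ v < n & all (fun e => E e.1 e.2) S].

Lemma subseq_map_inj (T U : eqType) (f : T -> U) (s1 s2 : seq T) : injective f ->
  subseq (map f s1) (map f s2) = subseq s1 s2.
Proof.
move=> fI; elim: s2 s1 => [|y s2 IH] [|x s1] //=.
by rewrite (inj_eq fI) -!IH; case: ifP.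
Qed.

Section OfInstance.
Variable I : instance.
Let f (e : 'I_(order I) * 'I_(order I)) : nat * nat := (val e.1, val e.2).

Definition inst_E : rel nat := fun u v => (u, v) \in [seq f e | e <- enum (edges I)].
Definition inst_S : seq (nat * nat) := map f (relaxations I).

Let fI : injective f.
Proof. by move=> [a b] [c e] [/val_inj -> /val_inj ->]. Qed.

Lemma inst_EE (u v : 'I_(order I)) : inst_E (val u) (val v) = ((u, v) \in edges I).
Proof. by rewrite /inst_E (mem_map fI _ (u, v)) mem_enum. Qed.

Lemma inst_wf : natwf (order I) inst_E (source I) inst_S.
Proof.
split; first exact: ltn_ord.
  by move=> u v /mapP[[a b] _ [-> ->]]; split; apply: ltn_ord.
apply/allP => _ /mapP[[a b] ab ->]; rewrite /= inst_EE.
exact: (allP (relaxations_edges I)).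
Qed.

Lemma inst_encode : encode I = natencode (order I) inst_E (source I) inst_S.
Proof.
rewrite /encode /natencode; congr (_ ++ (_ ++ (_ ++ _))); last first.
  by rewrite /inst_S -map_comp.
congr flatten; rewrite -val_enum_ord -map_comp; apply: eq_map => u /=.
by rewrite -map_comp; apply: eq_map => v /=; rewrite inst_EE.
Qed.

Lemma inst_valid : valid_relaxation_sequence (edges I) (source I) (relaxations I) <->
  natvalid inst_E (source I) inst_S.
Proof.
have P vs : path inst_E (source I) (map val vs) = path (fun u v => (u, v) \in edges I) (source I) vs.
  by rewrite path_map; apply: eq_path => u v; rewrite /= inst_EE.
have U vs : uniq (val (source I) :: map val vs) = uniq (source I :: vs).
  by rewrite -map_cons (map_inj_uniq val_inj).
have Z vs : zip (val (source I) :: map val vs) (map val vs) = map f (zip (source I :: vs) vs).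
  rewrite /=; elim: vs (source I) => //= v vs IH u; congr cons; exact: IH.
split=> H vs.
  move=> p u.
  have lt v : v \in vs -> v < order I.
    have [_ E _] := inst_wf.
    elim: vs (val (source I)) p {u} => //= w vs IH s /andP[/E[_ ws] /IH {}IH].
    by rewrite inE => /orP[/eqP ->|/IH].
  pose vs' := map (insubd (source I)) vs.
  have Evs : vs = map val vs'.
    rewrite /vs' -map_comp -[LHS]map_id; apply/eq_in_map => v /lt lv /=.
    by rewrite insubdK.
  move: p u; rewrite Evs P U Z => p u.
  by rewrite /inst_S subseq_map_inj //; apply: H.
move=> p u; rewrite /contains_path /= -(subseq_map_inj _ _ fI) -Z.
by apply: H; rewrite ?P ?U.
Qed.
End OfInstance.

Lemma eq_natencode n E E' s S : E =2 E' -> natencode n E s S = natencode n E' s S.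
Proof.
move=> H; rewrite /natencode; congr (_ ++ (_ ++ _)); congr flatten.
by apply: eq_map => u; apply: eq_map => v.
Qed.

Lemma eq_natvalid E E' s S : E =2 E' -> natvalid E s S -> natvalid E' s S.
Proof. by move=> H V vs; rewrite -(eq_path H); apply: V. Qed.

Lemma inst_of_nat n E s S : natwf n E s S ->
  exists I : instance, [/\ order I = n, inst_E I =2 E, val (source I) = s & inst_S I = S].
Proof.
move=> [sn En Sall].
pose ed := [set e : 'I_n * 'I_n | E e.1 e.2].
pose g (e : nat * nat) : 'I_n * 'I_n := (insubd (Ordinal sn) e.1, insubd (Ordinal sn) e.2).
have gE e : E e.1 e.2 -> val (g e).1 = e.1 /\ val (g e).2 = e.2.
  by move=> /En[l1 l2]; rewrite /g /= !val_insubd l1 l2.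
have H : all (fun e => e \in ed) (map g S).
  apply/allP => _ /mapP[e /(allP Sall) He ->].
  by have [g1 g2] := gE e He; rewrite inE [X in E X _]g1 [X in E _ X]g2.
exists (@Build_instance n ed (Ordinal sn) (map g S) H); split => //.
  move=> u v; apply/mapP/idP => /= [[[a b]]|Euv].
    by rewrite mem_enum inE => ? [-> ->].
  exists (g (u, v)); last by have [/= -> ->] := gE (u, v) Euv.
  by have [/= g1 g2] := gE (u, v) Euv; rewrite mem_enum inE /= g1 g2.
rewrite /inst_S /= -map_comp -[RHS]map_id; apply/eq_in_map => e /(allP Sall) He /=.
by have [-> ->] := gE e He; case: (e).
Qed.

Lemma validity_nat x : relaxation_validity x <->
  exists n E s S, [/\ natwf n E s S, x = natencode n E s S & natvalid E s S].
Proof.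
split=> [[I [-> /inst_valid V]]|[n [E [s [S [wf -> V]]]]]].
  exists (order I), (inst_E I), (source I), (inst_S I).
  by split; [apply: inst_wf|apply: inst_encode|].
have [I [I1 HE I2 I3]] := inst_of_nat wf; move: V; rewrite -I1 -I2 -I3 => V.
exists I; split; first by rewrite inst_encode; apply: eq_natencode => u v; rewrite HE.
by apply/inst_valid; apply: eq_natvalid V => u v; rewrite HE.
Qed.

(** * Decoding instances *)

(** This counts the letters [true] preceded by exactly [k] letters [false]: the number with index
    [k] in a sequence of unary codes, and 0 past the end. In this form it is a bounded sum. *)
Fixpoint block (w : word) (k : nat) : nat :=
  match w with
  | [::] => 0
  | true :: w' => (k == 0) + block w' k
  | false :: w' => if k is k'.+1 then block w' k' else 0
  end.

Definition encode_nats (s : seq nat) : word := flatten (map encode_nat s).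

Lemma encode_nats_cons b s : encode_nats (b :: s) = encode_nat b ++ encode_nats s.
Proof. by []. Qed.

Lemma block_encode_nat b w k :
  block (encode_nat b ++ w) k = if k is k'.+1 then block w k' else b.
Proof.
elim: b k => [|b IH] [|k] //=.
  by rewrite -/(encode_nat b) IH.
by rewrite -/(encode_nat b) IH.
Qed.

Lemma block_encode_nats s k : block (encode_nats s) k = nth 0 s k.
Proof.
elim: s k => [|b s IH] k; first by rewrite nth_nil.
by rewrite /encode_nats /= block_encode_nat -/(encode_nats s); case: k.
Qed.

Lemma size_encode_nat n : size (encode_nat n) = n.+1.
Proof. by rewrite size_rcons size_nseq. Qed.

Lemma count_encode_nats s : count negb (encode_nats s) = size s.
Proof.
elim: s => //= b s IH; rewrite /encode_nats /= count_cat -/(encode_nats s) IH.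
by rewrite /encode_nat -cats1 count_cat count_nseq /= mul0n.
Qed.

Lemma last_encode_nats s : last false (encode_nats s) = false.
Proof.
elim: s => //= b s; rewrite /encode_nats /= last_cat /encode_nat last_rcons.
by [].
Qed.

(** Being a sequence of unary codes thus depends on the last letter alone, which is all that
    [well_formed] has to test; the default covers the empty word. *)
Lemma encode_nats_of_word w : last false w = false -> exists s, w = encode_nats s.
Proof.
elim: w => [|b w IH]; first by exists [::].
case: b => /=; last by move=> /IH[s ->]; exists (0 :: s).
case: w IH => //= b w IH /IH [[|c s] E]; first by [].
by exists (c.+1 :: s); rewrite E.
Qed.

Lemma matrix_flatten (T : Type) (f : nat -> T) k n :
  flatten [seq [seq f (u * n + v) | v <- iota 0 n] | u <- iota 0 k] =
  [seq f i | i <- iota 0 (k * n)].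
Proof.
elim: k => // k IH; have -> : k.+1 * n = k * n + n by lia.
have -> : iota 0 k.+1 = iota 0 k ++ [:: k] by rewrite -addn1 iotaD.
rewrite iotaD !map_cat flatten_cat IH /= cats0 add0n.
have -> : iota (k * n) n = map (addn (k * n)) (iota 0 n) by rewrite -iotaDl addn0.
by rewrite -map_comp.
Qed.

Definition matrix_word (n : nat) (E : rel nat) : word :=
  flatten [seq [seq E u v | v <- iota 0 n] | u <- iota 0 n].

Lemma matrix_wordE n E : matrix_word n E = [seq E (i %/ n) (i %% n) | i <- iota 0 (n * n)].
Proof.
rewrite -matrix_flatten; congr flatten; apply: eq_map => u.
apply/eq_in_map => v; rewrite mem_iota /= => vn.
by rewrite divnMDl ?divn_small ?addn0 ?modnMDl ?modn_small //; lia.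
Qed.

Lemma size_matrix_word n E : size (matrix_word n E) = n * n.
Proof. by rewrite matrix_wordE size_map size_iota. Qed.

Lemma nth_matrix_word n E u v : u < n -> v < n -> nth false (matrix_word n E) (u * n + v) = E u v.
Proof.
move=> un vn; have H : u * n + v < n * n by nia.
rewrite matrix_wordE (nth_map 0) ?size_iota // nth_iota // add0n.
by rewrite divnMDl ?divn_small ?addn0 ?modnMDl ?modn_small //; lia.
Qed.

Definition pairs (S : seq (nat * nat)) : seq nat := flatten [seq [:: e.1; e.2] | e <- S].

Lemma natencodeE n E s S :
  natencode n E s S = encode_nat n ++ matrix_word n E ++ encode_nats (s :: pairs S).
Proof.
rewrite /natencode /encode_nats /=; congr (_ ++ (_ ++ (_ ++ _))).
by elim: S => //= e S ->; rewrite -catA.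
Qed.

Lemma size_pairs S : size (pairs S) = (size S).*2.
Proof. by elim: S => //= e S ->; rewrite doubleS. Qed.

Lemma nth_pairs S i e0 : i < size S ->
  (nth 0 (pairs S) i.*2, nth 0 (pairs S) i.*2.+1) = nth e0 S i.
Proof. by elim: S i => //= -[a b] S IH [|i] //=; rewrite ltnS => /IH <-. Qed.

Section Decoding.
Variable x : word.

Definition dec_order : nat := block x 0.
Definition dec_offset : nat := dec_order.+1 + dec_order * dec_order.
Definition dec_tail : word := drop dec_offset x.
Definition dec_edge (u v : nat) : bool :=
  [&& u < dec_order, v < dec_order & nth false x (dec_order.+1 + (u * dec_order + v))].
Definition dec_source : nat := block dec_tail 0.
Definition dec_length : nat := (count negb dec_tail) %/ 2.
Definition dec_step (i : nat) : nat * nat :=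
  (block dec_tail (2 * i).+1, block dec_tail (2 * i).+2).
Definition dec_seq : seq (nat * nat) := [seq dec_step i | i <- iota 0 dec_length].

(** The first condition places the last letter in the tail. The number of letters [false] in the
    tail is odd because the source contributes one and each edge of the sequence two. *)
Definition well_formed : bool :=
  [&& dec_offset < size x, ~~ nth false x (size x).-1, count negb dec_tail %% 2 == 1,
      dec_source < dec_order &
      all (fun i => dec_edge (dec_step i).1 (dec_step i).2) (iota 0 dec_length)].
End Decoding.

Lemma dec_natencode n E s S : natwf n E s S ->
  let x := natencode n E s S in
  [/\ dec_order x = n, dec_edge x =2 E, dec_source x = s, dec_seq x = S & well_formed x].
Proof.
move=> [sn En Sall] x.
have xE : x = encode_nat n ++ matrix_word n E ++ encode_nats (s :: pairs S) by apply: natencodeE.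
clearbody x.
have On : dec_order x = n by rewrite /dec_order xE block_encode_nat.
have Tn : dec_tail x = encode_nats (s :: pairs S).
  rewrite /dec_tail /dec_offset On xE addnC -drop_drop.
  rewrite drop_size_cat ?size_encode_nat // drop_size_cat ?size_matrix_word //.
have Ln : dec_length x = size S.
  by rewrite /dec_length Tn count_encode_nats /= size_pairs; lia.
have Stn i : i < size S -> dec_step x i = nth (0, 0) S i.
  move=> iS; rewrite /dec_step Tn !block_encode_nats /= -(nth_pairs (0, 0) iS).
  by rewrite mul2n.
have Sn : dec_seq x = S.
  rewrite /dec_seq Ln -[RHS](mkseq_nth (0, 0)) /mkseq; apply/eq_in_map => i.
  by rewrite mem_iota => /Stn.
have sn' : dec_source x = s by rewrite /dec_source Tn block_encode_nats.
have Edn : dec_edge x =2 E.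
  move=> u v; rewrite /dec_edge On.
  apply/and3P/idP => [[un vn]|Euv]; last have [un vn] := En _ _ Euv; last split=> //;
  by rewrite xE nth_cat size_encode_nat ltnNge leq_addr /= addKn nth_cat size_matrix_word
     (_ : u * n + v < n * n) ?nth_matrix_word //; nia.
split=> //; apply/and5P; split.
- rewrite /dec_offset On xE 2!size_cat size_encode_nat size_matrix_word.
  by rewrite addnA -[X in X < _]addn0 ltn_add2l encode_nats_cons size_cat size_encode_nat.
- rewrite nth_last; have : last false x = false.
    have L a : last a (encode_nats (s :: pairs S)) = false.
      by rewrite encode_nats_cons last_cat /encode_nat last_rcons last_encode_nats.
    by rewrite xE catA last_cat L.
  by case: (x) => //= b w ->.
- by rewrite Tn count_encode_nats /= size_pairs; lia.
- by rewrite sn' On.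
- apply/allP => i; rewrite mem_iota Ln => /andP[_ iS]; cbv beta; rewrite Stn // Edn.
  by apply: (allP Sall); apply: mem_nth.
Qed.

Lemma natencode_dec x : well_formed x ->
  natwf (dec_order x) (dec_edge x) (dec_source x) (dec_seq x) /\
  x = natencode (dec_order x) (dec_edge x) (dec_source x) (dec_seq x).
Proof.
case/and5P; set n := dec_order x => ox lx ct sn ed.
have x0 : x != [::] by case: (x) ox.
have lastx : last false x = false.
  by apply: negbTE; case: x lx x0 {n ox ct sn ed} => // b w; rewrite nth_last.
split.
  split=> //; first by move=> u v /and3P[].
  by rewrite /dec_seq all_map.
(* Decomposing the whole word, matrix included, serves to split off its first block, the order; the
   tail is decomposed again below. *)
have [s xs] := encode_nats_of_word lastx.
have [y xy] : exists y, x = encode_nat n ++ y.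
  rewrite /n /dec_order xs block_encode_nats.
  by case: s xs => [|b s] xs; [rewrite xs in x0 | exists (encode_nats s)].
have dy : drop n.+1 x = y by rewrite xy drop_size_cat ?size_encode_nat.
have ty : dec_tail x = drop (n * n) y by rewrite /dec_tail /dec_offset -/n addnC -drop_drop dy.
have sy : n * n < size y.
  by move: ox; rewrite /dec_offset -/n [size x](congr1 size xy) size_cat size_encode_nat ltn_add2l.
have ly : last false (dec_tail x) = false.
  rewrite ty; move: lastx; rewrite xy -{1}(cat_take_drop (n * n) y) !last_cat.
  by have : 0 < size (drop (n * n) y); [rewrite size_drop subn_gt0|case: (drop _ _)].
have [bs Eb] := encode_nats_of_word ly.
rewrite natencodeE {1}xy -[in LHS](cat_take_drop (n * n) y) -ty.
congr (_ ++ (_ ++ _)).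
  rewrite -/n matrix_wordE; apply: (@eq_from_nth _ false).
    by rewrite size_takel ?size_map ?size_iota // ltnW.
  move=> i; rewrite size_takel ?(ltnW sy) // => ilt.
  rewrite (nth_map 0) ?size_iota // nth_iota // add0n nth_take //.
  have n0 : 0 < n by case: (n) ilt.
  rewrite /dec_edge -/n ltn_mod n0 ltn_divLR // ilt /= -divn_eq xy nth_cat size_encode_nat.
  by rewrite ltnNge leq_addr /= addKn.
rewrite Eb; congr encode_nats; rewrite /dec_source Eb block_encode_nats.
move: ct; rewrite /dec_seq /dec_length Eb count_encode_nats => ct.
case: bs Eb ct => [//|b bs] Eb ct /=; congr cons.
have Sb : size bs = ((size bs).+1 %/ 2).*2 by move: ct; rewrite /=; lia.
apply: (@eq_from_nth _ 0); first by rewrite size_pairs size_map size_iota.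
move=> i ib; set S := [seq _ | _ <- _].
have sS : size S = (size bs).+1 %/ 2 by rewrite size_map size_iota.
have i2 : i./2 < size S by rewrite sS; lia.
have Ei := nth_pairs (0, 0) i2; move: Ei.
rewrite (nth_map 0) ?size_iota -?sS // nth_iota -?sS // add0n /dec_step Eb !block_encode_nats /=.
rewrite mul2n => -[E1 E2].
by rewrite -[i]odd_double_half; case: (odd i); rewrite ?add0n ?add1n ?E1 ?E2.
Qed.

(** The language asks for some instance with the given code. Decoding shows that this instance is
    unique up to extensional equality of the edge relation, so validity can be stated for it. *)
Lemma validity_natencode n E s S : natwf n E s S ->
  relaxation_validity (natencode n E s S) <-> natvalid E s S.
Proof.
move=> wf; have [_ HE Hs HS _] := dec_natencode wf.
split=> [/validity_nat[n' [E' [s' [S' [wf' Ex V]]]]]|V]; last first.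
  by apply/validity_nat; exists n, E, s, S.
have [_ HE' Hs' HS' _] := dec_natencode wf'.
move: Hs HS; rewrite /= Ex Hs' HS' => <- <-.
by apply: eq_natvalid V => u v; rewrite -HE -HE' Ex.
Qed.

Lemma validity_dec x : relaxation_validity x <->
  well_formed x /\ natvalid (dec_edge x) (dec_source x) (dec_seq x).
Proof.
split=> [/validity_nat[n [E [s [S [wf -> V]]]]]|[/natencode_dec[wf Ex] V]].
  have [_ HE -> -> ?] := dec_natencode wf; split=> //.
  by apply: eq_natvalid V => u v; rewrite HE.
by rewrite Ex; apply/validity_natencode.
Qed.

(** * From satisfiability to a path missed by the sequence *)

Lemma subseq_catP (T : eqType) (s a b : seq T) : subseq s (a ++ b) ->
  exists s1 s2, [/\ s = s1 ++ s2, subseq s1 a & subseq s2 b].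
Proof.
elim: a s => [|x a IH] s /=; first by move=> H; exists [::], s.
case: s => [|y s]; first by exists [::], [::]; split=> //; apply: sub0seq.
case: eqP => [->|_] /IH [s1 [s2 [E H1 H2]]].
  by exists (x :: s1), s2; rewrite E /= eqxx.
exists s1, s2; split=> //; case: s1 {E} H1 => [|z s1] //= H1.
by case: ifP => // _; apply: subseq_trans H1; apply: subseq_cons.
Qed.

Lemma subseq_skip (T : eqType) (x : T) s a b : x \notin a ->
  subseq (x :: s) (a ++ b) -> subseq (x :: s) b.
Proof.
move=> xa /subseq_catP[[|y s1] [s2 [E H1 H2]]]; first by rewrite E.
case: E => xy _; move: xa; rewrite xy.
by rewrite (mem_subseq H1) ?mem_head.
Qed.

(** The part matched inside [a] is both strictly increasing and nonincreasing, hence has at most one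
    element. *)
Lemma subseq_once (x : nat) s a b : sorted geq a -> path ltn x s ->
  subseq (x :: s) (a ++ b) -> subseq s b.
Proof.
move=> sa xs /subseq_catP[[|y s1] [s2 [E H1 H2]]].
  by apply: subseq_trans (subseq_cons s x) _; rewrite E.
case: E xs => -> ->; case: s1 H1 => [|z s1] H1 //= /andP[xz _].
have := subseq_sorted (rev_trans leq_trans) H1 sa.
by rewrite /= leqNgt xz.
Qed.

(** Each element of [s] is taken from a copy of its own. *)
Lemma subseq_flatten_nseq (T : eqType) (s l : seq T) k :
  {subset s <= l} -> size s <= k -> subseq s (flatten [seq l | _ <- iota 0 k]).
Proof.
elim: s k 0 => [|x s IH] [|k] i //= H sk; first exact: sub0seq.
rewrite -cat1s; apply: cat_subseq; first by rewrite sub1seq H ?mem_head.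
by apply: IH => // y ys; apply: H; rewrite inE ys orbT.
Qed.

(** * The graph of a system of clauses and its edge sequence *)

Section Graph.
Variables (nv nc : nat) (lit : nat -> nat -> bool).
Hypotheses (nv0 : 0 < nv) (nc0 : 0 < nc).

Definition top : nat := nv + nc.
Definition order_of : nat := top.+1 + 2 * nv * nc.
Definition item (l j : nat) : nat := top.+1 + (l * nc + j).
Definition item_lit (u : nat) : nat := (u - top.+1) %/ nc.
Definition item_clause (u : nat) : nat := (u - top.+1) %% nc.

(* Vertices [0 .. top] are terminals: terminal [i < nv] starts the choice of a
   value for variable [i], terminal [nv + j] the choice of a literal of clause
   [j].  The other vertices are the [item l j]; literal [l] stands for variable
   [l] if [l < nv], and for the negation of variable [l - nv] otherwise. *)
Definition graph : rel nat := fun u v =>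
  (u < order_of) && (v < order_of) &&
  (if u <= top then
     (top < v) &&
     (if u < nv then (v == item u 0) || (v == item (nv + u) 0)
      else (item_clause v == u - nv) && lit (u - nv) (item_lit v))
   else if v <= top then
     (v == nv + (item_clause u).+1) ||
     ((item_clause u == nc.-1) &&
      (v == (if item_lit u < nv then item_lit u else item_lit u - nv).+1))
   else (v == u.+1) && ((item_clause u).+1 < nc)).

(** Targets are listed in decreasing order, so that one such list can match at most one of several
    edges with increasing targets. *)
Definition edges_into (P : pred nat) : seq (nat * nat) :=
  flatten [seq flatten [seq (if graph u (order_of - i.+1) && P (order_of - i.+1)
                             then [:: (u, order_of - i.+1)] else [::])
                       | u <- iota 0 order_of]
          | i <- iota 0 order_of].

(** With [order_of] copies this absorbs any simple stretch of a path through items, whatever its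
    order, but never an edge into a terminal. *)
Definition item_edges : seq (nat * nat) :=
  flatten [seq edges_into (fun v => top < v) | _ <- iota 0 order_of].

(* A simple path visiting the terminals in the order [1, ..., top] misses the
   first list of each phase, and runs out of lists before the last terminal;
   any deviation gains one list. *)
Definition phase (t : nat) : seq (nat * nat) :=
  edges_into (fun v => (v <= top) && (v != t)) ++ item_edges ++
  edges_into (fun v => (v <= top) && (t < top)) ++ item_edges.

Definition graph_seq : seq (nat * nat) :=
  item_edges ++ flatten [seq phase t.+1 | t <- iota 0 top].

Lemma mem_edges_into P u v : ((u, v) \in edges_into P) = graph u v && P v.
Proof.
apply/flatten_mapP/idP => [[i _ /flatten_mapP[w _]]|/andP[uv Pv]].
  by case: ifP => // H; rewrite inE => /eqP[-> ->].
have /andP[/andP[un vn] _] := uv.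
exists (order_of - v.+1); first by rewrite mem_iota; lia.
have -> : order_of - (order_of - v.+1).+1 = v by lia.
apply/flatten_mapP; exists u; first by rewrite mem_iota.
by rewrite uv Pv mem_head.
Qed.

Lemma sorted_edges_into P : sorted geq (map snd (edges_into P)).
Proof.
rewrite /edges_into; set f := fun i => _.
suff H k i : sorted geq (map snd (flatten (map f (iota i k)))) /\
   forall v, v \in map snd (flatten (map f (iota i k))) -> v <= order_of - i.+1.
  by have [] := H order_of 0.
elim: k i => [|k IH] i //=; rewrite map_cat.
have [IH1 IH2] := IH i.+1.
have fi v : v \in map snd (f i) -> v = order_of - i.+1.
  case/mapP => -[a b] /flatten_mapP[w _]; case: ifP => // _.
  by rewrite inE => /eqP[_ ->] /= ->.
split; last first.
  by move=> v; rewrite mem_cat => /orP[/fi ->|/IH2] //; lia.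
elim: (map snd (f i)) fi => [|v s IHs] fi //=.
rewrite path_sortedE; last exact: rev_trans leq_trans.
rewrite IHs ?andbT; last by move=> w ws; apply: fi; rewrite inE ws orbT.
apply/allP => w /=; rewrite (fi v) ?mem_head // mem_cat => /orP[ws|/IH2]; last by lia.
by rewrite (fi w) // inE ws orbT.
Qed.

Lemma graph_bound u v : graph u v -> u < order_of /\ v < order_of.
Proof. by case/andP => /andP. Qed.

Lemma mem_item_edges u v : (u, v) \in item_edges -> graph u v && (top < v).
Proof. by case/flatten_mapP => i _; rewrite mem_edges_into. Qed.

Lemma graph_seq_wf : natwf order_of graph 0 graph_seq.
Proof.
split=> //; first exact: graph_bound.
apply/allP => -[u v]; rewrite mem_cat => /orP[/mem_item_edges/andP[]//|].
case/flatten_mapP => t _; rewrite /phase.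
rewrite mem_cat mem_edges_into => /orP[/andP[]//|].
rewrite mem_cat => /orP[/mem_item_edges/andP[]//|].
by rewrite mem_cat mem_edges_into => /orP[/andP[]//|/mem_item_edges/andP[]].
Qed.

(** * Which simple paths the sequence contains *)

Definition pedges (u : nat) (w : seq nat) := zip (u :: w) w.

Lemma pedges_cat u a b : pedges u (a ++ b) = pedges u a ++ pedges (last u a) b.
Proof. by rewrite /pedges; elim: a u => //= v a IH u; rewrite IH. Qed.

Notation terminals := (filter (fun v => v <= top)).

Lemma terminals_split w h hs : terminals w = h :: hs ->
  exists w1 w2, [/\ w = w1 ++ h :: w2, all (fun v => top < v) w1, terminals w2 = hs & h <= top].
Proof.
elim: w => //= v w IH; case: ifP => [vt [<- <-]|vt /IH[w1 [w2 [-> a E ht]]]].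
  by exists [::], w.
by exists (v :: w1), w2; rewrite /= a ltnNge vt.
Qed.

Lemma item_walk u w : path graph u w -> uniq w -> all (fun v => top < v) w ->
  subseq (pedges u w) item_edges.
Proof.
move=> p uw a; apply: subseq_flatten_nseq.
  rewrite /pedges; elim: w u p a {uw} => //= v w IH u /andP[uv p] /andP[tv a] e.
  rewrite inE => /orP[/eqP ->|]; first by rewrite mem_edges_into uv.
  exact: IH.
rewrite size2_zip //= -[X in _ <= X](size_iota 0); apply: uniq_leq_size => // v.
rewrite mem_iota /=; elim: w u p {uw a} => //= x w IH u /andP[/graph_bound[_ xn] p].
by rewrite inE => /orP[/eqP ->|] //; apply: IH p.
Qed.

Lemma phases_cons t r :
  flatten [seq phase i.+1 | i <- iota t r.+1] =
  edges_into (fun v => (v <= top) && (v != t.+1)) ++ item_edges ++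
  edges_into (fun v => (v <= top) && (t.+1 < top)) ++ item_edges ++
  flatten [seq phase i.+1 | i <- iota t.+1 r].
Proof. by rewrite [LHS]/= /phase -!catA. Qed.

(** Induction on the number [r] of phases left. A terminal in its turn is matched by the second list
    of the phase. A terminal out of turn is matched by the first list, and the second list takes the
    terminal after it; from then on fewer terminals than phases remain, so the last hypothesis holds
    by size. *)
Lemma walk_in_phases r t u w : t + r = top -> path graph u w -> uniq w ->
  size (terminals w) <= r -> terminals w <> iota t.+1 r ->
  subseq (pedges u w) (item_edges ++ flatten [seq phase i.+1 | i <- iota t r]).
Proof.
elim: r t u w => [|r IH] t u w tr p uw sz ne.
  by move: sz; rewrite leqn0 size_eq0 => /eqP E; case: ne; rewrite E.
have skip2 (a b c : seq (nat * nat)) : subseq a c -> subseq a (b ++ c).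
  by move=> H; apply: subseq_trans H (suffix_subseq _ _).
have skip1 (a b c : seq (nat * nat)) : subseq a b -> subseq a (b ++ c).
  by move=> H; apply: subseq_trans H (prefix_subseq _ _).
case E: (terminals w) sz ne => [|h hs] sz ne.
  apply: skip1; apply: item_walk => //.
  apply/allP => v vw; rewrite ltnNge; apply/negP => vt.
  have : v \in terminals w by rewrite mem_filter vt.
  by rewrite E.
have [w1 [w2 [Ew a1 E2 ht]]] := terminals_split E.
rewrite phases_cons; move: p uw; rewrite Ew cat_path cat_uniq /= => /and3P[p1 hE p2] /and3P[u1 _ /andP[_ u2]].
rewrite pedges_cat; apply: cat_subseq; first exact: item_walk.
rewrite -[pedges _ _]/([:: (last u w1, h)] ++ pedges h w2).
case: (eqVneq h t.+1) => [ht1|ht1].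
  (* In the last phase a terminal in its turn would complete the order, contrary to [ne]; so the
     second list of this phase is available. *)
  have tt : t.+1 < top.
    case: r IH tr sz ne => [|r] _ tr sz ne; last by lia.
    by case: hs E2 E sz ne => // ? _; rewrite ht1.
  apply/skip2/skip2; apply: cat_subseq.
    by rewrite sub1seq mem_edges_into hE ht tt.
  apply: IH => //; [lia | by rewrite E2|].
  by rewrite E2 => Ehs; apply: ne; rewrite ht1 Ehs.
apply: cat_subseq; first by rewrite sub1seq mem_edges_into hE ht.
case E3: (terminals w2) => [|h2 hs2].
  apply: skip1; apply: item_walk => //.
  apply/allP => v vw; rewrite ltnNge; apply/negP => vt.
  have : v \in terminals w2 by rewrite mem_filter vt.
  by rewrite E3.
have [w3 [w4 [Ew2 a3 E4 ht2]]] := terminals_split E3.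
rewrite -E2 E3 /= in sz.
move: p2 u2; rewrite Ew2 cat_path cat_uniq /= => /and3P[p3 h2E p4] /and3P[u3 _ /andP[_ u4]].
rewrite pedges_cat; apply: cat_subseq; first exact: item_walk.
rewrite -[pedges _ _]/([:: (last h w3, h2)] ++ pedges h2 w4); apply: cat_subseq.
  by rewrite sub1seq mem_edges_into h2E ht2; clear -tr sz; lia.
apply: IH => //; rewrite ?E4; [clear -tr; lia|clear -sz; lia|].
by move=> /(congr1 size); rewrite size_iota; clear -sz; lia.
Qed.

(** The target [t.+1] occurs neither in the item edges nor in the first list of its phase, so it
    waits for the second list, which by its decreasing order serves no later target. In the last
    phase the second list is empty. *)
Lemma ordered_not_in_phases r t : t + r = top -> 0 < r ->
  ~~ subseq (iota t.+1 r) (map snd (item_edges ++ flatten [seq phase i.+1 | i <- iota t r])).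
Proof.
elim: r t => // r IH t tr _; apply/negP.
have NI x : x <= top -> x \notin map snd item_edges.
  move=> xt; apply/mapP => -[[a b] /mem_item_edges/andP[_ code_time] /= E].
  by rewrite E leqNgt code_time in xt.
have NA : t.+1 \notin map snd (edges_into (fun v => (v <= top) && (v != t.+1))).
  apply/mapP => -[[a b]]; rewrite mem_edges_into => /and3P[_ _ b1] /= E.
  by rewrite E eqxx in b1.
have {NI} NI := NI t.+1 ltac:(lia).
have mc (a b c e f g : seq (nat * nat)) : map snd (a ++ b ++ c ++ e ++ f ++ g) =
    map snd a ++ map snd b ++ map snd c ++ map snd e ++ map snd (f ++ g).
  by rewrite !map_cat.
rewrite phases_cons mc /=.
move=> /(subseq_skip NI) /(subseq_skip NA) /(subseq_skip NI).
case: r IH tr => [|r] IH tr.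
  have NF : t.+1 \notin map snd (edges_into (fun v => (v <= top) && (t.+1 < top))).
    by apply/mapP => -[[a b]]; rewrite mem_edges_into => /andP[_ /andP[_ ?]]; lia.
  move=> /(subseq_skip NF) /mem_subseq /(_ t.+1 (mem_head _ _)).
  by rewrite cats0; apply/negP.
have lt : path ltn t.+1 (iota t.+2 r.+1).
  exact: (iota_ltn_sorted t.+1 r.+2).
move=> /(subseq_once (sorted_edges_into _) lt); apply/negP.
by apply: IH; lia.
Qed.

(** * From a path through all terminals in order to a satisfying assignment *)

Definition truth (a : nat -> bool) (l : nat) : bool := if l < nv then a l else ~~ a (l - nv).

Definition satisfiable : Prop :=
  exists a, forall j, j < nc -> exists l, [/\ l < 2 * nv, lit j l & truth a l].

Lemma item_clauseE l j : j < nc -> item_clause (item l j) = j.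
Proof. by move=> jc; rewrite /item_clause /item addKn modnMDl modn_small. Qed.

Lemma item_litE l j : j < nc -> item_lit (item l j) = l.
Proof. by move=> jc; rewrite /item_lit /item addKn divnMDl // divn_small // addn0. Qed.

Lemma item_decode v : top < v -> v = item (item_lit v) (item_clause v).
Proof. by move=> tv; rewrite /item /item_lit /item_clause -divn_eq; lia. Qed.

Lemma top_item l j : top < item l j.
Proof. by rewrite /item; lia. Qed.

Lemma item_lt l j : j < nc -> (item l j < order_of) = (l < 2 * nv).
Proof.
move=> jc; rewrite /item /order_of ltn_add2l; apply/idP/idP => H; last by nia.
by rewrite ltnNge; apply/negP => H2; nia.
Qed.

Lemma item_inj l j l' j' : j < nc -> j' < nc -> item l j = item l' j' -> l = l' /\ j = j'.
Proof.
move=> jc jc' E; split.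
  by rewrite -(item_litE l jc) E item_litE.
by rewrite -(item_clauseE l jc) E item_clauseE.
Qed.

Definition is_lit (i l : nat) := (l == i) || (l == nv + i).

Lemma graph_start i v : i < nv ->
  graph i v = (v == item i 0) || (v == item (nv + i) 0).
Proof.
move=> iv; rewrite /graph.
have -> : i <= top by rewrite /top; lia.
rewrite iv; case: eqVneq => [->|_] /=.
  by rewrite top_item item_lt // /order_of /top; lia.
case: eqVneq => [->|_] /=; last by rewrite !andbF.
by rewrite top_item item_lt // /order_of /top; lia.
Qed.

Lemma graph_choice j v : j < nc -> graph (nv + j) v =
  [&& v < order_of, top < v, item_clause v == j & lit j (item_lit v)].
Proof.
move=> jc; rewrite /graph.
have -> : nv + j <= top by rewrite /top; lia.
have -> : nv + j < nv = false by lia.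
have -> : nv + j - nv = j by lia.
have -> : nv + j < order_of by rewrite /order_of /top; lia.
by [].
Qed.

Lemma graph_item_item l j v : j < nc -> l < 2 * nv -> top < v ->
  graph (item l j) v = (j.+1 < nc) && (v == item l j.+1).
Proof.
move=> jc lv tv; rewrite /graph item_clauseE //.
have -> : item l j <= top = false by have := top_item l j; lia.
have -> : v <= top = false by lia.
rewrite item_lt // lv.
have -> : (item l j).+1 = item l j.+1 by rewrite /item; lia.
rewrite /= [RHS]andbC; case: eqVneq => [->|_]; last by rewrite andbF.
by case: (ltnP j.+1 nc) => H; rewrite ?andbF // item_lt ?lv.
Qed.

Lemma graph_item_top l j v : j < nc -> l < 2 * nv -> v <= top ->
  graph (item l j) v = (v == (nv + j).+1) ||
     ((j == nc.-1) && (v == (if l < nv then l else l - nv).+1)).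
Proof.
move=> jc lv tv; rewrite /graph item_clauseE // item_litE // tv addnS.
have -> : item l j <= top = false by have := top_item l j; lia.
have -> : v < order_of by rewrite /order_of; lia.
by rewrite item_lt // lv.
Qed.


(** Leaving a chain at clause [j] towards a clause terminal leads to [(nv + j).+1], which exceeds
    [i.+1]; reaching [i.+1] next requires running through the chain to its end. *)
Lemma chain_forced w l j i hs : path graph (item l j) w -> is_lit i l -> i < nv -> j < nc ->
  terminals w = i.+1 :: hs ->
  exists w1 w2, [/\ w = w1 ++ i.+1 :: w2, terminals w2 = hs &
    forall j', j < j' < nc -> item l j' \in w1].
Proof.
move=> p il iv; have lv : l < 2 * nv by case/orP: il => /eqP ->; lia.
elim: w j p => //= v w IH j /andP[jv p] jc; case: leqP => vt.
  move=> [vi Ehs]; exists [::], w; rewrite vi; split=> // j' jj'; exfalso.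
  by move: jv; rewrite graph_item_top // vi => /orP[|/andP[]] /eqP; lia.
move: jv p; rewrite graph_item_item // => /andP[j1 /eqP ->] p E.
have [w1 [w2 [-> E2 H]]] := IH _ p j1 E.
exists (item l j.+1 :: w1), w2; split=> // j' /andP[jj jc'].
rewrite inE; case: (eqVneq j' j.+1) => [->|ne]; first by rewrite eqxx.
by rewrite H ?orbT //; lia.
Qed.

Lemma variables_forced w i : path graph 0 w -> terminals w = iota 1 top -> i <= nv ->
  exists w1 w2, [/\ w = w1 ++ w2, last 0 w1 = i, terminals w2 = iota i.+1 (top - i) &
    forall i', i' < i -> exists2 l, is_lit i' l & forall j, j < nc -> item l j \in w1].
Proof.
move=> p E; elim: i => [|i IH] iv.
  by exists [::], w; split; rewrite ?subn0.
have [w1 [w2 [Ew Ei Et H]]] := IH (ltnW iv).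
have ti : top - i = (top - i.+1).+1 by rewrite /top; lia.
rewrite ti /= in Et.
move: p; rewrite Ew cat_path Ei => /andP[_].
case: w2 Ew Et => //= v w2 Ew Et /andP[]; rewrite graph_start // => vE p.
have [l [il vl]] : exists l, is_lit i l /\ v = item l 0.
  by case/orP: vE => /eqP ->; [exists i|exists (nv + i)]; rewrite /is_lit eqxx ?orbT.
rewrite vl in Ew p Et; rewrite leqNgt top_item /= in Et.
have [w3 [w4 [Ew2 Et2 H2]]] := chain_forced p il iv nc0 Et.
exists (w1 ++ item l 0 :: w3 ++ [:: i.+1]), w4; split=> //.
- by rewrite vl Ew2 -!catA /= -catA /=.
- by rewrite !last_cat /= last_cat.
move=> i'; rewrite ltnS leq_eqVlt => /orP[/eqP ->|/H [l' il' H']].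
  exists l => // j jc; rewrite mem_cat inE mem_cat.
  case: j jc => [|j] jc; first by rewrite eqxx orbT.
  by rewrite H2 ?orbT.
by exists l' => // j jc; rewrite mem_cat H'.
Qed.

(** Only the successor of a clause terminal is retained: the edge to it already names a literal of
    the clause. *)
Lemma clauses_forced w c k j : path graph c w -> c <= top -> c + k = top ->
  nv <= c -> terminals w = iota c.+1 k -> j < k ->
  exists2 v, v \in w & graph (c + j) v.
Proof.
elim: j c k w => [|j IH] c k w p ct ck cv E jk.
  case: w p E => [|v w] /=; first by case: k ck jk.
  by move=> /andP[cE _] _; exists v; rewrite ?mem_head ?addn0.
case: k ck E jk => // k ck E jk.
have [w1 [w2 [Ew _ E2 ct2]]] := terminals_split E.
move: p; rewrite Ew cat_path /= => /and3P[_ _ p2].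
have [v vw cE] := IH c.+1 k w2 p2 ct2 ltac:(lia) ltac:(lia) E2 jk.
by exists v; rewrite ?mem_cat ?inE ?vw ?orbT // addnS -addSn.
Qed.

Lemma satisfiable_of_walk w : path graph 0 w -> uniq w -> terminals w = iota 1 top -> satisfiable.
Proof.
move=> p uw E.
have [w1 [w2 [Ew E1 E2 H]]] := variables_forced p E (leqnn nv).
move: p uw; rewrite Ew cat_path E1 cat_uniq => /andP[_ p2] /and3P[_ /hasPn d _].
pose blocked l := all (fun j => item l j \in w1) (iota 0 nc).
exists (fun i => ~~ blocked i) => j jc.
have nvt : nv <= top by rewrite /top; lia.
have [v vw] := clauses_forced (j := j) p2 nvt (subnKC nvt) (leqnn nv) E2 ltac:(rewrite /top; lia).
rewrite graph_choice // => /and4P[vn tv /eqP vj vl].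
have Ev := item_decode tv; rewrite vj in Ev.
exists (item_lit v); move: (item_lit v) Ev vl => l Ev vl.
have lv : l < 2 * nv by rewrite -(item_lt l jc) -Ev.
have nb : ~~ blocked l.
  apply/allPn; exists j; first by rewrite mem_iota.
  by rewrite -Ev; apply: d.
split=> //; rewrite /truth; case: ltnP => // lnv; rewrite negbK.
have [|l' /orP[/eqP ->|/eqP ll'] H'] := H (l - nv); first by lia.
  by apply/allP => j'; rewrite mem_iota => /H'.
case/negP: nb; apply/allP => j'; rewrite mem_iota => /H'.
by rewrite ll' subnKC.
Qed.

(** * From a satisfying assignment to a simple path through all terminals in order *)

Section WalkOfAssignment.
Variable a : nat -> bool.
Hypothesis aP : forall j, j < nc -> exists l, [/\ l < 2 * nv, lit j l & truth a l].

Definition false_lit (i : nat) : nat := if a i then nv + i else i.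
Definition true_lit (j : nat) : nat := find (fun l => lit j l && truth a l) (iota 0 (2 * nv)).

Lemma true_litP j : j < nc -> [/\ true_lit j < 2 * nv, lit j (true_lit j) & truth a (true_lit j)].
Proof.
move=> /aP[l [lv ll tl]].
have H : has (fun l => lit j l && truth a l) (iota 0 (2 * nv)).
  by apply/hasP; exists l; rewrite ?mem_iota ?ll.
have lt : true_lit j < 2 * nv by rewrite -[X in _ < X](size_iota 0) -has_find.
have := nth_find 0 H; rewrite -/(true_lit j) nth_iota // add0n => /andP[? ?].
by split.
Qed.

Lemma false_litP i : i < nv -> [/\ false_lit i < 2 * nv, is_lit i (false_lit i) & ~~ truth a (false_lit i)].
Proof.
rewrite /false_lit /is_lit /truth => iv; case E: (a i); split; rewrite ?eqxx ?orbT //; try lia.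
  by rewrite ltnNge leq_addr /= addKn E.
by rewrite iv E.
Qed.

Definition chain (i : nat) : seq nat := rcons [seq item (false_lit i) j | j <- iota 0 nc] i.+1.
Definition choice (j : nat) : seq nat := [:: item (true_lit j) j; (nv + j).+1].
Definition walk : seq nat :=
  flatten [seq chain i | i <- iota 0 nv] ++ flatten [seq choice j | j <- iota 0 nc].

Lemma chain_path i : i < nv -> path graph i (chain i) && (last i (chain i) == i.+1).
Proof.
move=> iv; have [lv il _] := false_litP iv; rewrite /chain last_rcons eqxx andbT.
move: (false_lit i) lv il => l lv il.
have H k j : j + k = nc.-1 -> path graph (item l j) (rcons [seq item l j' | j' <- iota j.+1 k] i.+1).
  elim: k j => [|k IH] j E /=.
    rewrite andbT graph_item_top //; [|lia|rewrite /top; lia].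
    rewrite addn0 in E; rewrite E eqxx /=.
    by case/orP: il => /eqP ->; rewrite ?iv ?eqxx ?orbT // ltnNge leq_addr /= addKn eqxx orbT.
  rewrite graph_item_item ?top_item //; last by lia.
  rewrite eqxx andbT; apply/andP; split; first by lia.
  by apply: IH => //; lia.
have -> : iota 0 nc = 0 :: iota 1 nc.-1 by rewrite -{1}(prednK nc0).
rewrite /= graph_start //; apply/andP; split; last exact: H.
by case/orP: il => /eqP ->; rewrite eqxx ?orbT.
Qed.

Lemma variables_path k : k <= nv ->
  let w := flatten [seq chain i | i <- iota 0 k] in path graph 0 w && (last 0 w == k).
Proof.
elim: k => // k IH kv; have /andP[p /eqP l] := IH (ltnW kv).
cbv zeta; have -> : iota 0 k.+1 = iota 0 k ++ [:: k] by rewrite -addn1 iotaD.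
rewrite map_cat flatten_cat cat_path last_cat l p /= cats0.
exact: chain_path.
Qed.

Lemma clauses_path k : k <= nc ->
  let w := flatten [seq choice j | j <- iota 0 k] in path graph nv w && (last nv w == nv + k).
Proof.
elim: k => [|k IH] kc; first by rewrite /= addn0 eqxx.
have /andP[p /eqP l] := IH (ltnW kc).
have [lv ll _] := true_litP kc.
cbv zeta; have -> : iota 0 k.+1 = iota 0 k ++ [:: k] by rewrite -addn1 iotaD.
rewrite map_cat flatten_cat cat_path last_cat l p /= addnS eqxx !andbT.
rewrite graph_choice // top_item item_clauseE // item_litE // eqxx ll item_lt // lv /=.
by rewrite graph_item_top // ?eqxx // /top; lia.
Qed.

Lemma walk_path : path graph 0 walk.
Proof.
have /andP[p /eqP l] := variables_path (leqnn nv); have /andP[q _] := clauses_path (leqnn nc).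
by rewrite /walk cat_path p l.
Qed.

Lemma walk_terminals : terminals walk = iota 1 top.
Proof.
have t l j : item l j <= top = false by have := top_item l j; lia.
have H k i : i + k <= nv -> terminals (flatten [seq chain i | i <- iota i k]) = iota i.+1 k.
  elim: k i => //= k IH i ki; rewrite filter_cat IH; last by lia.
  rewrite /chain filter_rcons.
  have -> : i < top by rewrite /top; lia.
  rewrite (_ : filter _ [seq _ | _ <- _] = [::]) //.
  by elim: (iota 0 nc) => //= j s ->; rewrite t.
have H2 k j : j + k <= nc -> terminals (flatten [seq choice j | j <- iota j k]) = iota (nv + j).+1 k.
  elim: k j => //= k IH j kj; rewrite IH ?t; last by lia.
  have -> : nv + j < top by rewrite /top; lia.
  by rewrite addnS.
by rewrite /walk filter_cat H ?H2 ?addn0 // /top iotaD add1n.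
Qed.

Lemma walk_items : filter (fun v => top < v) walk =
  [seq item (false_lit i) j | i <- iota 0 nv, j <- iota 0 nc] ++
  [seq item (true_lit j) j | j <- iota 0 nc].
Proof.
have H k i : i + k <= nv -> filter (fun v => top < v) (flatten [seq chain i | i <- iota i k]) =
    [seq item (false_lit i) j | i <- iota i k, j <- iota 0 nc].
  elim: k i => //= k IH i ki; rewrite filter_cat IH; last by lia.
  congr cat; rewrite /chain filter_rcons.
  have -> : top < i.+1 = false by rewrite /top; lia.
  by apply/all_filterP/allP => _ /mapP[j _ ->]; apply: top_item.
have H2 k j : j + k <= nc -> filter (fun v => top < v) (flatten [seq choice j | j <- iota j k]) =
    [seq item (true_lit j) j | j <- iota j k].
  elim: k j => //= k IH j kj; rewrite IH; last by lia.
  have -> : top < (nv + j).+1 = false by rewrite /top; lia.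
  by rewrite top_item.
by rewrite /walk filter_cat H ?H2.
Qed.

(** Items on chains belong to false literals, chosen items to true ones; distinct chains belong to
    distinct variables and chosen items to distinct clauses. Terminals are treated apart. *)
Lemma walk_uniq : uniq (0 :: walk).
Proof.
have W0 : 0 \notin walk.
  have : 0 \notin terminals walk by rewrite walk_terminals mem_iota.
  by rewrite mem_filter.
rewrite /= W0 /=; rewrite -(perm_uniq (permEl (perm_filterC (fun v => v <= top) walk))).
rewrite cat_uniq walk_terminals iota_uniq /=.
rewrite (eq_filter (a2 := fun v => top < v)); last by move=> v /=; rewrite ltnNge.
rewrite walk_items; apply/andP; split.
  apply/hasPn => v; rewrite -walk_items mem_filter => /andP[tv _].
  by rewrite /= mem_iota; lia.
rewrite cat_uniq; apply/and3P; split.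
- apply: allpairs_uniq; rewrite ?iota_uniq // => -[i j] [i' j'].
  move=> /allpairsP[[x y] /= [xi yj [-> ->]]] /allpairsP[[x' y'] /= [xi' yj' [-> ->]]].
  rewrite !mem_iota /= in xi yj xi' yj' * => /(item_inj yj yj') [E ->]; congr pair.
  have [_ A1 B1] := false_litP xi; have [_ A2 B2] := false_litP xi'.
  by move: A1 A2; rewrite E /is_lit => /orP[] /eqP -> /orP[] /eqP; lia.
- apply/hasPn => v /mapP[j]; rewrite mem_iota => jc ->.
  apply/allpairsP => -[[i j'] /= []]; rewrite !mem_iota => iv jc' /(item_inj jc jc') [E _].
  have [_ _ A1] := true_litP jc; have [_ _ B1] := false_litP iv.
  by rewrite -E A1 in B1.
- rewrite map_inj_in_uniq ?iota_uniq // => j j'; rewrite !mem_iota => jc jc'.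
  by move=> /(item_inj jc jc') [].
Qed.
End WalkOfAssignment.

Theorem graph_seq_valid : ~ natvalid graph 0 graph_seq <-> satisfiable.
Proof.
split=> [nV|[a aP] V].
  apply: NNPP => ns; apply: nV => w p uw; rewrite -/(pedges 0 w).
  have uw' : uniq w by case/andP: uw.
  apply: walk_in_phases => //.
    rewrite -[X in _ <= X](size_iota 1); apply: uniq_leq_size; first exact: filter_uniq.
    move=> v; rewrite mem_filter mem_iota => /andP[vt vw].
    by case: v vt vw uw => // vt vw /andP[/negP[]].
  by move=> E; apply: ns; apply: satisfiable_of_walk E.
(* A matching of the walk would, after projection to targets and restriction to terminals, match
   [1, ..., top]. *)
have := @ordered_not_in_phases top 0 (add0n _) ltac:(rewrite /top; lia).
apply/negP/negPn; rewrite -(walk_terminals a).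
apply: subseq_trans (filter_subseq _ _) _.
have {1}-> : walk a = map snd (zip (0 :: walk a) (walk a)).
  by rewrite -/unzip2 unzip2_zip //=.
apply: map_subseq; apply: V; first exact: walk_path.
exact: walk_uniq.
Qed.
End Graph.

(** * Membership in coNP *)

(** Expressions read letters of the inputs only, so a suffix is given by its offset [o]; a letter
    [true] counts when exactly [k] letters [false] lie between [o] and it. *)
Lemma block_sum w o k : block (drop o w) k =
  \sum_(0 <= i < size w) [&& o <= i, nth false w i &
    \sum_(0 <= j < i) ((o <= j) && ~~ nth false w j) == k].
Proof.
elim: w o k => [|b w IH] o k; first by rewrite big_geq.
rewrite big_nat_recl // [X in _ + X](eq_bigr (fun i => [&& o <= i.+1, nth false w i &
   ((o == 0) && ~~ b) + \sum_(0 <= j < i) ((o <= j.+1) && ~~ nth false w j) == k] : nat)); last first.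
  by move=> i _; rewrite big_nat_recl // leqn0.
rewrite big_geq //=; case: o => [|o] /=; last by rewrite IH.
case: b => /=.
  rewrite eq_sym; congr (_ + _); rewrite -[in LHS](drop0 w) IH.
  by apply: eq_bigr => i _; rewrite add0n.
case: k => [|k]; first by rewrite big1 // => i _; rewrite andbF.
by rewrite add0n -[in LHS](drop0 w) IH.
Qed.

Lemma count_negb_sum w o :
  count negb (drop o w) = \sum_(0 <= i < size w) ((o <= i) && ~~ nth false w i).
Proof.
elim: w o => [|b w IH] o; first by rewrite big_geq.
rewrite big_nat_recl //; case: o => [|o]; last by rewrite /= IH.
by rewrite drop0 /= -[in LHS](drop0 w) IH.
Qed.

Section Computability.
Variables (d : nat) (W U : ctx d -> word).
Hypotheses (HW : input_word W) (HU : input_word U).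

Lemma definable_block (O K : ctx d -> nat) : definable O -> definable K ->
  definable (fun g => block (drop (O g) (W g)) (K g)).
Proof.
move=> HO HK; apply: (@definable_ext _ (fun g => \sum_(0 <= i < size (W g)) ([&& O g <= i, nth false (W g) i &
    \sum_(0 <= j < i) ((O g <= j) && ~~ nth false (W g) j : nat) == K g] : nat))) => [g|].
  by rewrite block_sum.
have HW2 := input_word_wk (input_word_wk HW); have HO2 := definable_wk (definable_wk HO).
by comp_auto.
Qed.

Lemma definable_count_negb (O : ctx d -> nat) : definable O ->
  definable (fun g => count negb (drop (O g) (W g))).
Proof.
move=> HO; apply: (@definable_ext _ (fun g => \sum_(0 <= i < size (W g)) ((O g <= i) && ~~ nth false (W g) i : nat))) => [g|].
  by rewrite count_negb_sum.
by comp_auto.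
Qed.

Lemma definable_first_block (K : ctx d -> nat) : definable K -> definable (fun g => block (W g) (K g)).
Proof.
move=> HK; apply: definable_ext (definable_block (definable_const _ 0) HK) => g.
by rewrite drop0.
Qed.

Lemma definable_dec_order : definable (fun g => dec_order (W g)).
Proof. exact: (definable_first_block (definable_const _ 0)). Qed.

Lemma definable_dec_offset : definable (fun g => dec_offset (W g)).
Proof. by have H := definable_dec_order; rewrite /dec_offset; comp_auto. Qed.

Lemma definable_dec_tail_block (K : ctx d -> nat) : definable K -> definable (fun g => block (dec_tail (W g)) (K g)).
Proof. exact: (definable_block definable_dec_offset). Qed.

Lemma definable_dec_source : definable (fun g => dec_source (W g)).
Proof. exact: (definable_dec_tail_block (definable_const _ 0)). Qed.

Lemma definable_dec_zeros : definable (fun g => count negb (dec_tail (W g))).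
Proof. exact: (definable_count_negb definable_dec_offset). Qed.

Lemma definable_dec_length : definable (fun g => dec_length (W g)).
Proof. exact: (definable_div definable_dec_zeros (definable_const _ 2)). Qed.

Lemma bdefinable_dec_edge (A B : ctx d -> nat) : definable A -> definable B ->
  bdefinable (fun g => dec_edge (W g) (A g) (B g)).
Proof. by move=> HA HB; have H := definable_dec_order; rewrite /dec_edge; comp_auto. Qed.

Lemma definable_dec_step1 (K : ctx d -> nat) : definable K -> definable (fun g => (dec_step (W g) (K g)).1).
Proof. by move=> HK; apply: (definable_dec_tail_block (K := fun g => (2 * K g).+1)); comp_auto. Qed.

Lemma definable_dec_step2 (K : ctx d -> nat) : definable K -> definable (fun g => (dec_step (W g) (K g)).2).
Proof. by move=> HK; apply: (definable_dec_tail_block (K := fun g => (2 * K g).+2)); comp_auto. Qed.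
End Computability.

Lemma bdefinable_well_formed d (W : ctx d -> word) : input_word W -> bdefinable (fun g => well_formed (W g)).
Proof.
move=> HW; have H1 := definable_dec_offset HW; have H2 := definable_dec_zeros HW.
have H3 := definable_dec_source HW; have H4 := definable_dec_order HW; have H5 := definable_dec_length HW.
rewrite /well_formed; apply: bdefinable_and; first by comp_auto.
apply: bdefinable_and; first by comp_auto.
apply: bdefinable_and; first by apply: bdefinable_eq; [apply: definable_mod|]; comp_auto.
apply: bdefinable_and; first by comp_auto.
apply: bdefinable_all => //.
have HW1 := input_word_wk HW.
by apply: (bdefinable_dec_edge HW1); [apply: (definable_dec_step1 HW1)|apply: (definable_dec_step2 HW1)]; comp_auto.
Qed.

(** * Certificates of invalidity *)

Section Certificate.
Variables x u : word.

(* The certificate lists in unary the length of a path, its vertices, and the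
   number of edges of the path matched greedily after each step of the
   sequence. *)
Definition cert_length : nat := block u 0.
Definition cert_vertex (k : nat) : nat := block u k.+1.
(** Block 0 is the length and the next [cert_length.+1] blocks are the vertices, hence the shift by
    two. *)
Definition cert_matched (i : nat) : nat := block u (cert_length + i).+2.

Definition cert_step (i : nat) : nat :=
  if [&& cert_matched i < cert_length, (dec_step x i).1 == cert_vertex (cert_matched i)
       & (dec_step x i).2 == cert_vertex (cert_matched i).+1]
  then (cert_matched i).+1 else cert_matched i.

Definition check_certificate : bool :=
  [&& cert_vertex 0 == dec_source x,
      all (fun k => dec_edge x (cert_vertex k) (cert_vertex k.+1)) (iota 0 cert_length),
      all (fun k => all (fun j => cert_vertex j != cert_vertex k) (iota 0 k)) (iota 0 cert_length.+1),
      cert_matched 0 == 0,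
      all (fun i => cert_matched i.+1 == cert_step i) (iota 0 (dec_length x)) &
      cert_matched (dec_length x) < cert_length].
End Certificate.

Lemma bdefinable_check_certificate d (W U : ctx d -> word) : input_word W -> input_word U ->
  bdefinable (fun g => check_certificate (W g) (U g)).
Proof.
have cL e (V : ctx e -> word) : input_word V -> definable (fun g => cert_length (V g)).
  by move=> HV; apply: (definable_first_block HV (definable_const _ 0)).
have cV e (V : ctx e -> word) K : input_word V -> definable K -> definable (fun g => cert_vertex (V g) (K g)).
  by move=> HV HK; apply: (definable_first_block HV (definable_succ HK)).
have cM e (V : ctx e -> word) K : input_word V -> definable K -> definable (fun g => cert_matched (V g) (K g)).
  by move=> HV HK; apply: (definable_first_block HV); apply/definable_succ/definable_succ/definable_add => //; apply: cL.
move=> HW HU; have HW1 := input_word_wk HW; have HU1 := input_word_wk HU; have HU2 := input_word_wk HU1.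
have v1 := @definable_var d; have v2 := @definable_var d.+1; have v21 := @definable_var1 d.
have vs1 := definable_succ v1.
apply: bdefinable_and; first by apply: bdefinable_eq; [apply: cV => //; comp_auto|exact: definable_dec_source].
apply: bdefinable_and.
  apply: bdefinable_all; first exact: cL.
  by apply: (bdefinable_dec_edge HW1); apply: (cV _ _ _ HU1).
apply: bdefinable_and.
  apply: bdefinable_all; first by apply/definable_succ/cL.
  apply: bdefinable_all => //.
  by apply/bdefinable_not/bdefinable_eq; apply: (cV _ _ _ HU2).
apply: bdefinable_and; first by apply: bdefinable_eq; [apply: cM => //; comp_auto|comp_auto].
apply: bdefinable_and; last by apply: bdefinable_leq; [apply/definable_succ/cM => //; exact: definable_dec_length|exact: cL].
apply: bdefinable_all; first exact: definable_dec_length.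
have m1 := cM _ _ _ HU1 v1.
apply: bdefinable_eq; first exact: (cM _ _ _ HU1 vs1).
apply: definable_if => //; last exact: definable_succ.
apply: bdefinable_and; first by apply: bdefinable_leq; [exact: definable_succ|exact: (cL _ _ HU1)].
apply: bdefinable_and; apply: bdefinable_eq.
- exact: (definable_dec_step1 HW1 v1).
- exact: (cV _ _ _ HU1 m1).
- exact: (definable_dec_step2 HW1 v1).
- exact: (cV _ _ _ HU1 (definable_succ m1)).
Qed.

(** Invariant: [s] embeds in [S] iff what greedy matching has left of [s] after [i] steps embeds in
    what is left of [S]. *)
Lemma greedy_subseq (T : eqType) (e0 : T) (s S : seq T) (g : nat -> nat) :
  g 0 = 0 ->
  (forall i, i < size S ->
     g i.+1 = if (g i < size s) && (nth e0 S i == nth e0 s (g i)) then (g i).+1 else g i) ->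
  (forall i, i <= size S -> g i <= size s) /\ (g (size S) < size s) = ~~ subseq s S.
Proof.
move=> g0 gS.
have H i : i <= size S -> g i <= size s /\ subseq s S = subseq (drop (g i) s) (drop i S).
  elim: i => [|i IH] iS; first by rewrite g0 !drop0.
  have [gi ->] := IH (ltnW iS); rewrite gS //.
  case: (ltnP (g i) (size s)) => gs /=; last by rewrite drop_oversize // !sub0seq gi.
  rewrite (drop_nth e0 iS) (drop_nth e0 gs) /= eq_sym.
  by case: eqP => _ //; rewrite -?(drop_nth e0 gs).
split; first by move=> i /H[].
have [gs ->] := H _ (leqnn _); rewrite drop_size subseq0.
by rewrite -size_eq0 size_drop subn_eq0 -ltnNge.
Qed.

Lemma pedges_map (f : nat -> nat) k L :
  pedges (f k) [seq f i.+1 | i <- iota k L] = [seq (f i, f i.+1) | i <- iota k L].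
Proof. by rewrite /pedges; elim: L k => //= L IH k; rewrite IH. Qed.

Lemma path_map_iota (e : rel nat) (f : nat -> nat) k L :
  path e (f k) [seq f i.+1 | i <- iota k L] = all (fun i => e (f i) (f i.+1)) (iota k L).
Proof. by elim: L k => //= L IH k; rewrite IH. Qed.

Lemma size_dec_seq x : size (dec_seq x) = dec_length x.
Proof. by rewrite size_map size_iota. Qed.

Lemma nth_dec_seq x i e0 : i < dec_length x -> nth e0 (dec_seq x) i = dec_step x i.
Proof. by move=> il; rewrite (nth_map 0) ?size_iota // nth_iota. Qed.

Lemma check_certificate_sound x u : check_certificate x u ->
  ~ natvalid (dec_edge x) (dec_source x) (dec_seq x).
Proof.
rewrite /check_certificate; set L := cert_length u; set v := cert_vertex u; set g := cert_matched u.
case/and5P => /eqP v0 pv uv /eqP g0 /andP[/allP gS gL] V.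
have uq : uniq [seq v k | k <- iota 0 L.+1].
  rewrite map_inj_in_uniq ?iota_uniq // => a b; rewrite !mem_iota => aL bL ab.
  case: (ltngtP a b) => // lt.
    have /allP/(_ a) := allP uv b ltac:(by rewrite mem_iota).
    by rewrite mem_iota /= ab eqxx => /(_ lt).
  have /allP/(_ b) := allP uv a ltac:(by rewrite mem_iota).
  by rewrite mem_iota /= ab eqxx => /(_ lt).
have := V [seq v i.+1 | i <- iota 0 L]; rewrite -v0 path_map_iota => /(_ pv).
have -> : v 0 :: [seq v i.+1 | i <- iota 0 L] = [seq v k | k <- iota 0 L.+1].
  by rewrite /= -[1]addn0 iotaDl -map_comp.
move=> /(_ uq).
have -> : [seq v k | k <- iota 0 L.+1] = v 0 :: [seq v i.+1 | i <- iota 0 L].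
  by rewrite /= -[1]addn0 iotaDl -map_comp.
rewrite -/(pedges _ _) pedges_map; set s := map _ _.
have sL : size s = L by rewrite size_map size_iota.
have := @greedy_subseq _ (0, 0) s (dec_seq x) g g0.
rewrite size_dec_seq sL => /(_ _)[|_].
  move=> i il; have /eqP -> := gS i ltac:(by rewrite mem_iota).
  rewrite /cert_step -/g -/L -/v nth_dec_seq //; case: ltnP => //= gi.
  by rewrite /s (nth_map 0) ?size_iota // nth_iota // add0n; case: (dec_step x i).
by rewrite gL => /esym/negP.
Qed.

Lemma size_encode_nats_le s m : all (fun b => b <= m) s -> size (encode_nats s) <= size s * m.+1.
Proof.
elim: s => //= b s IH /andP[bm /IH sm]; rewrite encode_nats_cons size_cat size_encode_nat.
by rewrite mulSn leq_add.
Qed.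

(** The certificate has one block for the length, at most [size x] for the vertices and at most
    [(size x).+1] for the counters; every number in it is at most [size x], hence takes at most
    [(size x).+1] letters. *)
Lemma check_certificate_complete x : well_formed x ->
  ~ natvalid (dec_edge x) (dec_source x) (dec_seq x) ->
  exists2 u, size u <= (2 * size x + 3) * (size x).+1 & check_certificate x u.
Proof.
move=> wf nV.
have [vs [pv uv nS]] : exists vs, [/\ path (dec_edge x) (dec_source x) vs, uniq (dec_source x :: vs) &
    ~~ subseq (pedges (dec_source x) vs) (dec_seq x)].
  apply: NNPP => H; apply: nV => vs pv uv.
  by apply/negPn/negP => ns; apply: H; exists vs.
have [[sn En _] _] := natencode_dec wf.
set s := dec_source x in pv uv nS sn *; set n := dec_order x in sn En *.
have vn : all (fun v => v < n) (s :: vs).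
  rewrite /= sn /=; elim: vs (s) pv {uv nS} => //= w vs IH v /andP[/En[_ ->] /IH].
  by [].
have Ln : (size vs).+1 <= n.
  rewrite -[_.+1]/(size (s :: vs)) -[n](size_iota 0); apply: uniq_leq_size => // v vv.
  by rewrite mem_iota; apply: (allP vn).
have nx : n <= size x by case/and5P: wf; rewrite /dec_offset -/n; lia.
have lx : dec_length x <= size x.
  rewrite /dec_length; apply: leq_trans (leq_div _ _) _; apply: leq_trans (count_size _ _) _.
  by rewrite size_drop leq_subr.
set L := size vs in Ln *; pose v := nth 0 (s :: vs).
pose fix g i := if i is j.+1 then
  (if (g j < L) && (dec_step x j == (v (g j), v (g j).+1)) then (g j).+1 else g j) else 0.
have Epe : pedges s vs = [seq (v i, v i.+1) | i <- iota 0 L].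
  rewrite -pedges_map; congr pedges.
  by rewrite -[LHS](mkseq_nth 0).
have [gL gS] := @greedy_subseq _ (0, 0) (pedges s vs) (dec_seq x) g erefl ltac:(
  rewrite Epe size_dec_seq size_map size_iota => i il /=; rewrite nth_dec_seq //;
  case: ltnP => //= gi; by rewrite (nth_map 0) ?size_iota // nth_iota).
rewrite Epe size_dec_seq size_map size_iota -Epe nS in gL gS.
set gs := [seq g i | i <- iota 0 (dec_length x).+1].
have gsz : size gs = (dec_length x).+1 by rewrite size_map size_iota.
have gsb : all (fun b => b <= size x) gs.
  by rewrite all_map; apply/allP => i; rewrite mem_iota => /= il; have := gL i il; lia.
have gsE i : i <= dec_length x -> nth 0 gs i = g i.
  by move=> il; rewrite (nth_map 0) ?size_iota // nth_iota.
clearbody gs.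
pose u := encode_nats (L :: (s :: vs) ++ gs).
exists u.
  apply: leq_trans (size_encode_nats_le (m := size x) _) _.
    rewrite -[L :: _]/([:: L] ++ (s :: vs) ++ gs) !all_cat gsb andbT /= andbT.
    apply/andP; split; first by lia.
    by apply: sub_all vn => w /= wn; lia.
  by rewrite leq_mul2r /= size_cat gsz -/L; lia.
have cL : cert_length u = L by rewrite /cert_length block_encode_nats.
have cV k : k <= L -> cert_vertex u k = v k.
  move=> kL; rewrite /cert_vertex block_encode_nats.
  by rewrite -[nth _ _ _]/(nth 0 ((s :: vs) ++ gs) k) nth_cat /= ltnS kL.
have cM i : i <= dec_length x -> cert_matched u i = g i.
  move=> il; rewrite /cert_matched cL block_encode_nats.
  rewrite -[nth _ _ _]/(nth 0 ((s :: vs) ++ gs) (L + i).+1) nth_cat.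
  by rewrite -[size (s :: vs)]/L.+1 ltnS ltnNge leq_addr /= -addSn addKn gsE.
apply/and5P; split; last apply/andP; try split.
- by rewrite cV.
- rewrite cL -/L; apply/allP => k; rewrite mem_iota /= => kL; rewrite !cV //; last exact: ltnW.
  move: pv; rewrite -{1}(mkseq_nth 0 vs) /mkseq -/L -[s]/(v 0) (path_map_iota _ v) => /allP; apply.
  by rewrite mem_iota.
- rewrite cL; apply/allP => k; rewrite mem_iota /= => kL; apply/allP => j; rewrite mem_iota /= => jk.
  have jL : j <= L by lia.
  have kL' : k <= L by lia.
  by rewrite !cV // /v nth_uniq // neq_ltn jk.
- by rewrite cM.
- apply/allP => i; rewrite mem_iota /= => il; rewrite cM // /cert_step cM ?cL; last exact: ltnW.
  rewrite -[g i.+1]/(if (g i < L) && (dec_step x i == (v (g i), v (g i).+1)) then (g i).+1 else g i).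
  case: (ltnP (g i) L) => // gi; rewrite !cV //; last exact: ltnW.
- by rewrite cM // cL gS.
Qed.

Theorem coNP_validity : coNP relaxation_validity.
Proof.
have [q Hq] : exists q : {poly nat}, forall n, (2 * n + 3) * n.+1 <= q.[n]%R.
  apply: polyb_horner; apply: (@polyb_comp (fun n => n)) polyb_id _.
  have E : (fun n => (2 * n + 3) * n.+1) = (fun n => (2 * n + 3) * (n + 1)).
    by apply: functional_extensionality => n; rewrite addn1.
  rewrite E; by repeat first [exact: polyb_id | exact: polyb_const | apply: polybD | apply: polybM].
(* A word encoding no instance lies outside the language, so it is accepted with any certificate. *)
exists (fun x u => ~~ well_formed x || check_certificate x u), q; split.
  apply: polytime_relation_bdefinable; apply: bdefinable_or.
    by apply/bdefinable_not/bdefinable_well_formed; apply: input_word_fst.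
  by apply: bdefinable_check_certificate; [exact: input_word_fst|exact: input_word_snd].
move=> x; rewrite validity_dec; case: (boolP (well_formed x)) => wf /=; last first.
  by split=> [_|_ []//]; exists [::].
split=> [nV|[u [_ /check_certificate_sound nV]] [_ V]]; last exact: nV.
have [|u uq cu] := check_certificate_complete wf; first by move=> V; apply: nV.
by exists u; split=> //; apply: leq_trans uq (Hq _).
Qed.

(** * Turing machine tableaux *)

Section Tableau.
Variable M : TM.
Notation tapeno := 'I_(tm_tapes M).+1.
Notation sy := (option (bool + tm_aux M)).
Notation fact := (tm_state M + tapeno * sy)%type.

(* Index of the clause families: [inl (s, r, Some (i, a))] and [inl (s, r, None)]
   propagate the cells and the state when the state is [s] and the symbols read
   are [r]; the others fix the initial configuration, except that the cells of
   the second word are only required to hold a bit or a blank, blanks being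
   followed by blanks; [inr (inr None)] forbids the output [false]. *)
Notation family := ((tm_state M * {ffun tapeno -> sy}) * option (tapeno * sy)
                    + (option (tapeno * sy) + option bool))%type.

Section Clauses.
Variables (x : word) (q T : nat).

(* Cells are numbered relatively to the head, which is always on cell [T]; the
   cells at distance at most [T - t] from the head matter at time [t]. *)
Definition width : nat := (T + T).+1.

(** Halting states idle, as they do under [step], so that every run fills all [T] rows of
    transitions. *)
Definition action (s : tm_state M) (r : {ffun tapeno -> sy}) : tm_state M * (tapeno -> sy * move) :=
  if tm_halt s then (s, fun i => (r i, Stay)) else tm_delta s r.

(** As the head stays on cell [T], a move renumbers the other cells in the opposite direction: [c']
    is the new number of cell [c]. *)
Definition shifted (d : move) (c c' : nat) : bool :=
  match d with Left => c' == c.+1 | Stay => c' == c | Right => c'.+1 == c end.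

Definition shiftable (d : move) (c : nat) : bool :=
  match d with Left => c.+1 < width | Stay => true | Right => 0 < c end.

(** The [q] cells of tape 1 from the head onwards are left open; they hold the certificate to be
    guessed. *)
Definition known (i : tapeno) (a : sy) (c : nat) : bool :=
  match a with
  | None => if (i : nat) == 0 then (c < T) || (T + size x <= c)
            else if (i : nat) == 1 then (c < T) || (T + q <= c) else true
  | Some (inl b) => [&& (i : nat) == 0, T <= c, c < T + size x & nth false x (c - T) == b]
  | Some (inr _) => false
  end.

Definition premise (s : tm_state M) (r : {ffun tapeno -> sy}) (f : fact) : bool :=
  match f with inl s' => s' == s | inr (i, a) => a == r i end.

Definition guessed (f : fact) : bool :=
  match f with
  | inr (i, a) => ((i : nat) == 1) && (if a is Some (inr _) then false else true)
  | _ => false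
  end.

Definition blank_guess (f : fact) : bool :=
  match f with
  | inr (i, a) => ((i : nat) == 1) && (a == None)
  | _ => false
  end.

(* The literal of sign [b] on the fact [f] at time [t'] and cell [c'] occurs in
   the clause of family [k] at time [t] and cell [c]; a clause which makes no
   sense there contains all literals. *)
Definition occurs (k : family) (t c : nat) (b : bool) (f : fact) (t' c' : nat) : bool :=
  match k with
  | inl ((s, r), Some (i, a)) =>
      let w := (action s r).2 i in
      [|| ~~ ((t < T) && shiftable w.2 c),
          [&& ~~ b, t' == t, c' == T & premise s r f],
          [&& ~~ b, t' == t, c' == c & f == inr (i, a)]
        | [&& b, t' == t.+1, shifted w.2 c c' &
              (if c == T then f == inr (i, w.1) else f == inr (i, a))]]
  | inl ((s, r), None) =>
      [|| ~~ (t < T), [&& ~~ b, t' == t, c' == T & premise s r f]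
        | [&& b, t' == t.+1, c' == T & f == inl (action s r).1]]
  | inr (inl (Some (i, a))) =>
      ~~ ((t == 0) && known i a c) || [&& b, t' == 0, c' == c & f == inr (i, a)]
  | inr (inl None) =>
      ~~ (t == 0) || [&& b, t' == 0, c' == T & f == inl (tm_start M)]
  | inr (inr (Some true)) =>
      ~~ [&& t == 0, 0 < tm_tapes M, T <= c & c < T + q]
      || [&& b, t' == 0, c' == c & guessed f]
  | inr (inr (Some false)) =>
      [|| ~~ [&& t == 0, 0 < tm_tapes M, T <= c & c < T + q],
          [&& ~~ b, t' == 0, c' == c & blank_guess f]
        | [&& b, t' == 0, c' == c.+1 & blank_guess f]]
  | inr (inr None) =>
      ~~ (t == T) || [&& ~~ b, t' == T, c' == T & f == inr (ord0, Some (inl false))]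
  end.

Definition holds (val : nat -> nat -> fact -> bool) (k : family) (t c : nat) : Prop :=
  exists f t' c', [/\ t' <= T, c' < width & occurs k t c (val t' c' f) f t' c'].

Hypothesis qT : q < T.

Definition cell (tp : tape M) (c : nat) : sy :=
  if T <= c then nth None tp.2 (c - T) else nth None tp.1 (T - c.+1).

Lemma cell_shift d (a : sy) (tp : tape M) c c' : shifted d c c' ->
  cell (tape_move d (tape_write a tp)) c' = if c == T then a else cell tp c.
Proof.
case: tp => l r; case: d => /= /eqP; rewrite /cell /tape_write /=.
- move=> ->; case: (ltngtP c T) => cT /=.
  + case: (leqP T c.+1) => cT'.
      have -> : c.+1 - T = 0 by lia.
      have -> : T - c.+1 = 0 by lia.
      by rewrite /= nth0.
    have -> : T - c.+1 = (T - c.+2).+1 by lia.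
    by rewrite nth_behead.
  + have -> : T <= c.+1 by lia.
    have -> : c.+1 - T = (c - T).+1 by lia.
    have -> : c - T = (c - T).-1.+1 by lia.
    by rewrite /= nth_behead.
  + have -> : T <= c.+1 by lia.
    by have -> : c.+1 - T = 1 by lia.
- move=> ->; case: (ltngtP c T) => cT //=; last by have -> : c - T = 0 by lia.
  have -> : c - T = (c - T).-1.+1 by lia.
  by rewrite /= nth_behead.
- move=> <-; case: (ltngtP c'.+1 T) => cT /=.
  + have -> : T <= c' = false by lia.
    have -> : T - c'.+1 = (T - c'.+2).+1 by lia.
    by [].
  + have -> : T <= c' by lia.
    have -> : c'.+1 - T = (c' - T).+1 by lia.
    by rewrite nth_behead.
  + have -> : T <= c' = false by lia.
    by have -> : T - c'.+1 = 0 by lia.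
Qed.

Lemma cell_head (tp : tape M) : cell tp T = tape_read tp.
Proof. by rewrite /cell leqnn subnn nth0. Qed.

Definition config_at (u : word) (t : nat) : config M := iter t (@step M) (init_config M [:: x; u]).

Definition reads_at (c : config M) : {ffun tapeno -> sy} := [ffun i => tape_read (c.2 i)].

Lemma step_state (c : config M) : (step c).1 = (action c.1 (reads_at c)).1.
Proof.
rewrite /step /action; case: ifP => // _.
by rewrite -/(reads_at c); case: tm_delta.
Qed.

Lemma step_cell (c : config M) i p p' :
  shifted ((action c.1 (reads_at c)).2 i).2 p p' ->
  cell ((step c).2 i) p' =
  if p == T then ((action c.1 (reads_at c)).2 i).1 else cell (c.2 i) p.
Proof.
rewrite /step /action; case: ifP => [_ /= /eqP ->|_].
  by case: eqP => // ->; rewrite cell_head ffunE.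
rewrite -/(reads_at c); case: tm_delta => s' act /= H.
exact: cell_shift.
Qed.

Lemma cell_init u i c : cell ((config_at u 0).2 i) c =
  if c < T then None else nth None [seq Some (inl b) | b <- nth [::] [:: x; u] i] (c - T).
Proof. by rewrite /cell leqNgt /=; case: ltnP => // _; rewrite nth_nil. Qed.

Lemma knownP u i a c : size u <= q -> known i a c -> cell ((config_at u 0).2 i) c = a.
Proof.
move=> uq; rewrite cell_init; case: a => [[b|a]|] //=.
  case: i => -[|i] Hi //= /and3P[Tc cx /eqP <-].
  by rewrite ltnNge Tc /= (nth_map false) //; lia.
case: i => -[|[|i]] Hi //=.
- by case: ltnP => //= Tc xc; rewrite nth_default // size_map; lia.
- by case: ltnP => //= Tc xc; rewrite nth_default // size_map; lia.
- by rewrite [nth [::] _ _]nth_nil /= nth_nil; case: ifP.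
Qed.

Definition truth_of (u : word) (t c : nat) (f : fact) : bool :=
  match f with
  | inl s => (c == T) && ((config_at u t).1 == s)
  | inr (i, a) => cell ((config_at u t).2 i) c == a
  end.

(** Either the transition clauses for [s] and [r] describe the actual step, or one of their premises
    is false and satisfies them as a negative literal. *)
Lemma premise_truth u s r t :
  ((config_at u t).1 == s) && (reads_at (config_at u t) == r) \/
  exists2 f, premise s r f & ~~ truth_of u t T f.
Proof.
case: (eqVneq (config_at u t).1 s) => /= [Es|ns]; last first.
  by right; exists (inl s); rewrite /= eqxx.
case: (eqVneq (reads_at (config_at u t)) r) => /= [Er|nr]; [by left | right].
have [i ni] : exists i, reads_at (config_at u t) i != r i.
  apply/existsP; rewrite -negb_forall; apply: contra nr => /forallP H.
  by apply/eqP/ffunP => i; apply/eqP.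
by exists (inr (i, r i)); rewrite /= ?eqxx // cell_head; rewrite ffunE in ni.
Qed.

Lemma holds_of_run u : size u <= q -> cell ((config_at u T).2 ord0) T != Some (inl false) ->
  forall k t c, t <= T -> c < width -> holds (truth_of u) k t c.
Proof.
move=> uq out k t c tT cw.
have w0 : T < width by rewrite /width; lia.
case: k => [[[s r] [[i a]|]]|[[[i a]|]|[[]|]]].
- set w := (action s r).2 i.
  case Ac : ((t < T) && shiftable w.2 c); last first.
    (* The clause makes no sense at this place and contains all literals, so the witness is
       arbitrary. *)
    by exists (inl s), 0, T; rewrite /= -/w Ac.
  have /andP[tT' sc] := Ac.
  have [/andP[/eqP Es /eqP Er]|[f Hf nf]] := premise_truth u s r t; last first.
    by exists f, t, T; split=> //; rewrite /= (negbTE nf) !eqxx Hf orbT.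
  have [c' cc' c'w] : exists2 c', shifted w.2 c c' & c' < width.
    case: w.2 sc => /= sc; [exists c.+1|exists c|exists c.-1] => //=; rewrite /width in cw sc *; lia.
  have Ew : cell ((config_at u t.+1).2 i) c' = if c == T then w.1 else cell ((config_at u t).2 i) c.
    have cc2 : shifted ((action (config_at u t).1 (reads_at (config_at u t))).2 i).2 c c'.
      by rewrite Es Er.
    by rewrite [LHS](step_cell cc2) Es Er.
  case: (eqVneq c T) Ew => [cT|cT] Ew.
    exists (inr (i, w.1)), t.+1, c'; split=> //.
    have cTb : c == T by rewrite cT.
    by rewrite /occurs -/w /truth_of Ew cTb !eqxx cc' !orbT.
  case: (eqVneq (cell ((config_at u t).2 i) c) a) => [ca|ca].
    exists (inr (i, a)), t.+1, c'; split=> //.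
    by rewrite /occurs -/w /truth_of Ew ca (negbTE cT) !eqxx cc' !orbT.
  exists (inr (i, a)), t, c; split=> //.
  by rewrite /= (negbTE ca) !eqxx !orbT.
- case: (ltnP t T) => tT'; last first.
    by exists (inl s), 0, T; rewrite /= [t < T]ltnNge tT'.
  have [/andP[/eqP Es /eqP Er]|[f Hf nf]] := premise_truth u s r t; last first.
    by exists f, t, T; split=> //; rewrite /= (negbTE nf) !eqxx Hf orbT.
  exists (inl (action s r).1), t.+1, T; split=> //.
  by rewrite /= step_state Es Er !eqxx !orbT.
- case K : ((t == 0) && known i a c); last first.
    by exists (inl (tm_start M)), 0, T; rewrite /= K.
  exists (inr (i, a)), 0, c; split=> //.
  have /andP[_ ka] := K.
  by rewrite [occurs _ _ _ _ _ _ _]/= K /truth_of (knownP uq ka) !eqxx.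
- exists (inl (tm_start M)), 0, T; split=> //.
  by rewrite /= !eqxx orbT.
- case K : [&& t == 0, 0 < tm_tapes M, T <= c & c < T + q]; last first.
    by exists (inl (tm_start M)), 0, T; rewrite /= K.
  have /and4P[_ tp _ _] := K.
  pose i : tapeno := inord 1.
  have i1 : i = 1 :> nat by rewrite inordK.
  set a := cell ((config_at u 0).2 i) c.
  have ga : guessed (inr (i, a)).
    rewrite /guessed i1 /a cell_init i1 [nth [::] _ _]/=; case: ifP => // _.
    case: (ltnP (c - T) (size u)) => H; last by rewrite nth_default // size_map.
    by rewrite (nth_map false).
  exists (inr (i, a)), 0, c; split=> //.
  by rewrite /occurs K /truth_of -/a !eqxx ga.
- case K : [&& t == 0, 0 < tm_tapes M, T <= c & c < T + q]; last first.
    by exists (inl (tm_start M)), 0, T; rewrite /= K.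
  have /and4P[_ tp Tc cq] := K.
  pose i : tapeno := inord 1.
  have i1 : i = 1 :> nat by rewrite inordK.
  case: (ltnP (c - T) (size u)) => H.
    have E : cell ((config_at u 0).2 i) c = Some (inl (nth false u (c - T))).
      by rewrite cell_init i1 ltnNge Tc /= (nth_map false).
    exists (inr (i, None)), 0, c; split=> //.
    by rewrite /occurs K /truth_of E /blank_guess i1 !eqxx.
  have E : cell ((config_at u 0).2 i) c.+1 = None.
    by rewrite cell_init i1; case: ifP => // _; rewrite /= nth_default // size_map; lia.
  exists (inr (i, None)), 0, c.+1; split=> //; first by rewrite /width; lia.
  by rewrite /occurs K /truth_of E /blank_guess i1 !eqxx orbT.
- case: (eqVneq t T) => [_|tT']; last by exists (inl (tm_start M)), 0, T; rewrite /= tT'.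
  exists (inr (ord0, Some (inl false))), T, T; split=> //.
  by rewrite /= (negbTE out) !eqxx orbT.
Qed.

(** * From an assignment satisfying the tableau to an accepting run *)

Section RunOfTruth.
Variable val : nat -> nat -> fact -> bool.
Hypothesis valP : forall k t c, t <= T -> c < width -> holds val k t c.

(** Several symbols may be true at one cell, so a choice is made: [true] first, then [false], and a
    blank only if neither bit is there. *)
Definition guess (p : nat) : option bool :=
  if val 0 (T + p) (inr (inord 1, Some (inl true))) then Some true
  else if val 0 (T + p) (inr (inord 1, Some (inl false))) then Some false else None.

Definition guessed_word : word :=
  [seq guess p == Some true | p <- iota 0 (find (fun p => guess p == None) (iota 0 q))].

Lemma size_guessed_word : size guessed_word <= q.
Proof. by rewrite size_map size_iota -[X in _ <= X](size_iota 0); apply: find_size. Qed.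

Lemma known_holds i a c : c < width -> known i a c -> val 0 c (inr (i, a)).
Proof.
move=> cw ka; have [f [t' [c' [_ _]]]] := valP (inr (inl (Some (i, a)))) (leq0n T) cw.
by rewrite /occurs ka /= => /and4P[v /eqP <- /eqP <- /eqP <-].
Qed.

(** At the first cell without a bit the clause on guessed symbols forces a blank, and at [q] a blank
    is prescribed; the clauses on neighbouring cells carry the blank onwards. *)
Lemma blank_holds p : 0 < tm_tapes M -> size guessed_word <= p -> p <= q ->
  val 0 (T + p) (inr (inord 1, None)).
Proof.
move=> tp; rewrite size_map size_iota; set n := find _ _ => np pq.
have i1 : (inord 1 : tapeno) = 1 :> nat by rewrite inordK.
have nq : n <= q by apply: leq_trans np pq.
have eqf f : blank_guess f -> f = inr (inord 1, None).
  by case: f => //= -[i a] /andP[/eqP i1' /eqP ->]; congr (inr (_, _)); apply: val_inj; rewrite /= i1 i1'.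
have -> : p = n + (p - n) by lia.
have : n + (p - n) <= q by lia.
elim: (p - n) => [|d IH] dq.
  rewrite addn0; move: nq; rewrite leq_eqVlt => /orP[/eqP nq|nq].
    by apply: known_holds; rewrite /known ?i1 /width /= ?nq ?leqnn ?orbT //; lia.
  have cw : T + n < width by rewrite /width; lia.
  have [f [t' [c' [_ _]]]] := valP (inr (inr (Some true))) (leq0n T) cw.
  rewrite /occurs eqxx tp leq_addr ltn_add2l nq /= => /and4P[v /eqP t0 /eqP Ec gf].
  have hf : has (fun p => guess p == None) (iota 0 q) by rewrite has_find size_iota.
  have := nth_find 0 hf; rewrite -/n nth_iota // add0n /guess.
  move: v gf; rewrite t0 Ec; case: f => //= -[i a] v /andP[/eqP i1' ga].
  have Ei : i = inord 1 by apply: val_inj; rewrite /= i1.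
  by move: v; rewrite Ei; case: a ga => [[[]|//]|//] _ ->; [|case: ifP].
have cw : T + (n + d) < width by rewrite /width; lia.
have [f [t' [c' [_ _]]]] := valP (inr (inr (Some false))) (leq0n T) cw.
have dq' : n + d < q by lia.
rewrite /occurs eqxx tp leq_addr ltn_add2l dq' /= => /orP[] /and4P[v /eqP t0 /eqP Ec /eqf Ef].
  by move: v; rewrite t0 Ec Ef IH // ltnW.
by move: v; rewrite t0 Ec Ef -!addnS.
Qed.

Lemma init_holds i c : c < width ->
  val 0 c (inr (i, cell ((config_at guessed_word 0).2 i) c)).
Proof.
move=> cw; rewrite cell_init.
case: ltnP => cT.
  apply: known_holds => //; rewrite /known.
  by case: ifP => _; [rewrite cT|case: ifP; rewrite ?cT].
case: i => -[|[|i]] Hi; last first.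
- by apply: known_holds => //; rewrite [nth [::] _ _]nth_nil /= nth_nil.
- rewrite [nth [::] _ _]/=.
  have Ei : Ordinal Hi = inord 1 by apply: val_inj; rewrite /= inordK.
  case: (ltnP (c - T) (size guessed_word)) => cs; last first.
    rewrite nth_default 1?size_map // Ei; case: (ltnP (c - T) q) => cq.
      by rewrite -(subnKC cT); apply: blank_holds; lia.
    by apply: known_holds => //; rewrite /known inordK //=; lia.
  rewrite (nth_map false) // Ei.
  have := cs; rewrite size_map size_iota => cs'.
  rewrite /guessed_word (nth_map 0) ?size_iota // nth_iota // add0n.
  have := before_find 0 cs'; rewrite nth_iota ?add0n; last first.
    by apply: leq_trans cs' _; rewrite -[X in _ <= X](size_iota 0); apply: find_size.
  by rewrite /guess subnKC //; case: ifP => //=; case: ifP.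
- rewrite [nth [::] _ _]/=.
  case: (ltnP (c - T) (size x)) => cs.
    rewrite (nth_map false) //; apply: known_holds => //=.
    by rewrite cT eqxx andbT; lia.
  by rewrite nth_default 1?size_map //; apply: known_holds => //=; lia.
Qed.

(** Each transition clause is an implication whose premises hold by induction, so its conclusion
    holds. The range of cells shrinks by one on each side per step, as nothing is prescribed about
    what enters from outside. *)
Lemma run_holds t : t <= T ->
  val t T (inl (config_at guessed_word t).1) /\
  forall i c, t <= c -> c + t < width ->
    val t c (inr (i, cell ((config_at guessed_word t).2 i) c)).
Proof.
have w0 : T < width by rewrite /width; lia.
set u := guessed_word.
elim: t => [|t IH] tT.
  split; last by move=> i c _; rewrite addn0; apply: init_holds.
  have [f [t' [c' [_ _]]]] := valP (inr (inl None)) (leq0n T) w0.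
  by rewrite /occurs /= => /and4P[v /eqP <- /eqP <- /eqP <-].
have [IH1 IH2] := IH (ltnW tT).
set s := (config_at u t).1 in IH1; set r := reads_at (config_at u t).
have NP f : premise s r f -> val t T f.
  case: f => [s' /eqP -> //|[i a] /eqP ->]; rewrite /r ffunE -cell_head.
  by apply: IH2; rewrite /width; lia.
split.
  have [f [t' [c' [_ _]]]] := valP (inl ((s, r), None)) (ltnW tT) w0.
  rewrite /occurs tT /= => /orP[|] /and4P[v /eqP Et /eqP Ec].
    by move=> /NP; rewrite -Et -Ec (negbTE v).
  by move=> /eqP Ef; rewrite step_state -/s -/r -Ef -Et -Ec.
move=> i c' tc' c'w.
set w := (action s r).2 i.
have [c [cc' sc tc cw]] : exists c, [/\ shifted w.2 c c', shiftable w.2 c, t <= c & c + t < width].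
  case: w.2; [exists c'.-1|exists c'|exists c'.+1]; rewrite /shifted /shiftable ?eqxx;
    by split => //; lia.
have cw' : c < width by lia.
have Ew := @step_cell (config_at u t) i _ _ cc'; rewrite -/s -/r -/w in Ew.
rewrite [cell _ _]Ew {Ew}.
set a := cell ((config_at u t).2 i) c.
have [f [t1 [c1 [_ _]]]] := valP (inl ((s, r), Some (i, a))) (ltnW tT) cw'.
rewrite /occurs -/w tT sc /= => /or3P[] /and4P[v /eqP Et].
- by move=> /eqP Ec /NP; rewrite -Et -Ec (negbTE v).
- by move=> /eqP Ec /eqP Ef; move: v; rewrite Et Ec Ef IH2.
move=> sc1; have Ec : c1 = c'.
  by case: w.2 cc' sc1 => /= /eqP H1 /eqP H2; lia.
by case: ifP => _ /eqP Ef; move: v; rewrite Et Ec Ef.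
Qed.

Lemma run_of_holds : cell ((config_at guessed_word T).2 ord0) T != Some (inl false).
Proof.
have w0 : T < width by rewrite /width; lia.
have [_ H] := run_holds (leqnn T).
have {}H := H ord0 T (leqnn T) ltac:(rewrite /width; lia).
have [f [t1 [c1 [_ _]]]] := valP (inr (inr None)) (leqnn T) w0.
rewrite /occurs eqxx /= => /and4P[v /eqP Et /eqP Ec /eqP Ef].
by apply: contraNneq v; rewrite Et Ec Ef => <-.
Qed.
End RunOfTruth.
End Clauses.
End Tableau.

(** * Numbering the tableau *)

Section Numbering.
Variable M : TM.
Notation tapeno := 'I_(tm_tapes M).+1.
Notation sy := (option (bool + tm_aux M)).
Notation fact := (tm_state M + tapeno * sy)%type.
Notation family := ((tm_state M * {ffun tapeno -> sy}) * option (tapeno * sy)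
                    + (option (tapeno * sy) + option bool))%type.

Definition number (T A t c r : nat) : nat := (t * width T + c) * A + r.

Lemma number_mod T A t c r : r < A -> number T A t c r %% A = r.
Proof. by move=> rA; rewrite /number modnMDl modn_small. Qed.

Lemma number_time T A t c r : r < A -> c < width T -> number T A t c r %/ A %/ width T = t.
Proof.
move=> rA cw; rewrite /number divnMDl; last by lia.
by rewrite (divn_small rA) addn0 divnMDl // divn_small // addn0.
Qed.

Lemma number_cell T A t c r : r < A -> c < width T -> number T A t c r %/ A %% width T = c.
Proof.
move=> rA cw; rewrite /number divnMDl; last by lia.
by rewrite (divn_small rA) addn0 modnMDl modn_small.
Qed.

Lemma number_decode T A v : 0 < A ->
  number T A (v %/ A %/ width T) (v %/ A %% width T) (v %% A) = v.
Proof. by move=> A0; rewrite /number -!divn_eq. Qed.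

Lemma number_lt T A t c r : t <= T -> c < width T -> r < A ->
  number T A t c r < T.+1 * width T * A.
Proof. by rewrite /number; move: (width T) => W tT cW rA; nia. Qed.

Lemma number_time_le T A v : 0 < A -> v < T.+1 * width T * A -> v %/ A %/ width T <= T.
Proof. by move=> A0 vT; rewrite -ltnS !ltn_divLR. Qed.

Definition nvars (T : nat) : nat := T.+1 * width T * #|{: fact}|.
Definition nclauses (T : nat) : nat := T.+1 * width T * #|{: family}|.

(** Numbers are decoded by quantifying over the fixed types of families and facts and comparing
    ranks, which unfolds into a definable disjunction. Literals from [nvars T] on are the negative
    ones. *)
Definition tableau_lit (x : word) (q T j l : nat) : bool :=
  let v := if l < nvars T then l else l - nvars T in
  [exists k : family, [exists f : fact,
    [&& j %% #|{: family}| == enum_rank k, v %% #|{: fact}| == enum_rank f &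
        occurs x q T k (j %/ #|{: family}| %/ width T) (j %/ #|{: family}| %% width T)
          (l < nvars T) f (v %/ #|{: fact}| %/ width T) (v %/ #|{: fact}| %% width T)]]].

Lemma fact_gt0 : 0 < #|{: fact}|.
Proof. by apply/card_gt0P; exists (inl (tm_start M)). Qed.

Lemma family_gt0 : 0 < #|{: family}|.
Proof. by apply/card_gt0P; exists (inr (inr None)). Qed.

Lemma nvars_gt0 T : 0 < nvars T.
Proof. by rewrite !muln_gt0 fact_gt0. Qed.

Lemma nclauses_gt0 T : 0 < nclauses T.
Proof. by rewrite !muln_gt0 family_gt0. Qed.

Lemma tableau_satisfiable x q T :
  satisfiable (nvars T) (nclauses T) (tableau_lit x q T) <->
  exists val : nat -> nat -> fact -> bool,
    forall k t c, t <= T -> c < width T -> holds x q T val k t c.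
Proof.
have w0 : 0 < width T by [].
have rF (f : fact) : enum_rank f < #|{: fact}| := ltn_ord _.
have rK (k : family) : enum_rank k < #|{: family}| := ltn_ord _.
split=> [[a aP]|[val valP]].
  exists (fun t c f => a (number T #|{: fact}| t c (enum_rank f))) => k t c tT cw.
  have [l [lv + tl]] := aP _ (number_lt tT cw (rK k)).
  case/existsP=> k' /existsP[f]; rewrite number_mod // number_time // number_cell //.
  case/and3P => /eqP/ord_inj/enum_rank_inj <-.
  set v := (if l < _ then l else _) => /eqP vf oc.
  have vv : v < nvars T by rewrite /v; case: (ltnP l (nvars T)) => // H; rewrite ltn_subLR // addnn -mul2n.
  exists f, (v %/ #|{: fact}| %/ width T), (v %/ #|{: fact}| %% width T); split.
  - exact: number_time_le fact_gt0 vv.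
  - by rewrite ltn_mod.
  rewrite -vf number_decode ?fact_gt0 //.
  suff -> : a v = (l < nvars T) by [].
  by move: tl; rewrite /truth /v; case: ltnP => // _ /negbTE.
exists (fun v => [exists f : fact, (v %% #|{: fact}| == enum_rank f) &&
   val (v %/ #|{: fact}| %/ width T) (v %/ #|{: fact}| %% width T) f]) => j jc.
have jk : j %% #|{: family}| < #|{: family}| by rewrite ltn_mod family_gt0.
pose k : family := enum_val (Ordinal jk).
have Ek : j %% #|{: family}| = enum_rank k by rewrite /k enum_valK.
have cw : j %/ #|{: family}| %% width T < width T by rewrite ltn_mod.
have [f [t [c [tT cT oc]]]] := valP k _ _ (number_time_le family_gt0 jc) cw.
set n := number T #|{: fact}| t c (enum_rank f).
have nlt : n < nvars T := number_lt tT cT (rF f).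
have En : [exists f' : fact, (n %% #|{: fact}| == enum_rank f') &&
   val (n %/ #|{: fact}| %/ width T) (n %/ #|{: fact}| %% width T) f'] = val t c f.
  rewrite number_mod // number_time // number_cell //.
  apply/existsP/idP => [[f' /andP[/eqP/ord_inj/enum_rank_inj <-]] //|vf].
  by exists f; rewrite eqxx.
(* The literal on variable [n] whose sign agrees with the value of the fact: [n] itself or
   [nvars T + n]. *)
have H : exists2 l, l < 2 * nvars T & (l < nvars T) = val t c f /\
    (if l < nvars T then l else l - nvars T) = n.
  case: (val t c f); first by exists n; rewrite ?nlt //; lia.
  by exists (nvars T + n); rewrite ?ltnNge ?leq_addr /= ?addKn //; lia.
have [l lv [lb ln]] := H; exists l; split=> //.
  apply/existsP; exists k; apply/existsP; exists f.
  by rewrite ln lb Ek number_mod // number_time // number_cell // !eqxx.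
rewrite /truth; case E : (l < _); rewrite E in lb ln; rewrite ln En -lb //.
Qed.

Lemma bdefinable_occurs d (W : ctx d -> word) (Q TT U V C D : ctx d -> nat) (B : ctx d -> bool)
    (k : family) (f : fact) :
  input_word W -> definable Q -> definable TT -> definable U -> definable V -> bdefinable B -> definable C -> definable D ->
  bdefinable (fun g => occurs (W g) (Q g) (TT g) k (U g) (V g) (B g) f (C g) (D g)).
Proof.
move=> HW HQ HT HU HV HB HC HD.
case: k => [[[s r] [[i a]|]]|[[[i a]|]|[[]|]]]; rewrite /occurs.
- by case: (action s r).2 => a' []; rewrite /shiftable /shifted /width /=; comp_auto.
- by comp_auto.
- by rewrite /known; case: i => -[|[|i]] Hi; case: a => [[b|a]|] /=; comp_auto.
- by comp_auto.
- by comp_auto.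
- by comp_auto.
- by comp_auto.
Qed.

Lemma bdefinable_tableau_lit d (W : ctx d -> word) (Q TT J L : ctx d -> nat) :
  input_word W -> definable Q -> definable TT -> definable J -> definable L ->
  bdefinable (fun g => tableau_lit (W g) (Q g) (TT g) (J g) (L g)).
Proof.
move=> HW HQ HT HJ HL; rewrite /tableau_lit.
have HN : definable (fun g => nvars (TT g)) by rewrite /nvars /width; comp_auto.
have HV : definable (fun g => if L g < nvars (TT g) then L g else L g - nvars (TT g)) by comp_auto.
have HWd : definable (fun g => width (TT g)) by rewrite /width; comp_auto.
apply: bdefinable_exists => k; apply: bdefinable_exists => f.
apply: bdefinable_and; first by apply: bdefinable_eq; [apply: definable_mod|]; comp_auto.
apply: bdefinable_and; first by apply: bdefinable_eq; [apply: definable_mod|]; comp_auto.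
by apply: bdefinable_occurs => //; try (by comp_auto); first [apply: definable_div|apply: definable_mod];
  rewrite //; apply: definable_div; comp_auto.
Qed.
End Numbering.

(** * Hardness for coNP *)

Definition encode_edges (S : seq (nat * nat)) : word :=
  flatten [seq encode_nat e.1 ++ encode_nat e.2 | e <- S].

Section EncodeEdges.
Variable d : nat.

Lemma wdefinable_edges_cat (S1 S2 : ctx d -> seq (nat * nat)) :
  wdefinable (fun g => encode_edges (S1 g)) -> wdefinable (fun g => encode_edges (S2 g)) ->
  wdefinable (fun g => encode_edges (S1 g ++ S2 g)).
Proof.
move=> H1 H2; apply: wdefinable_ext (wdefinable_cat H1 H2) => g.
by rewrite /encode_edges map_cat flatten_cat.
Qed.

Lemma wdefinable_edges_for (F : ctx d -> nat) (S : ctx d -> nat -> seq (nat * nat)) :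
  definable F -> wdefinable (d := d.+1) (fun g => encode_edges (S g.1 g.2)) ->
  wdefinable (fun g => encode_edges (flatten [seq S g i | i <- iota 0 (F g)])).
Proof.
move=> HF HS; apply: wdefinable_ext (wdefinable_for (W := fun g i => encode_edges (S g i)) HF HS) => g.
by elim: (iota _ _) => //= i s ->; rewrite /encode_edges map_cat flatten_cat.
Qed.

Lemma wdefinable_edges_if (P : ctx d -> bool) (U V : ctx d -> nat) : bdefinable P -> definable U -> definable V ->
  wdefinable (fun g => encode_edges (if P g then [:: (U g, V g)] else [::])).
Proof.
move=> HP HU HV; apply: wdefinable_ext (wdefinable_if HP
  (wdefinable_cat (wdefinable_encode_nat HU) (wdefinable_encode_nat HV))) => g.
by case: (P g); rewrite /encode_edges /= ?cats0.
Qed.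
End EncodeEdges.

(** * Definability of the reduction *)

Section GraphEncoding.
Variables (nv nc : word -> nat) (lit : word -> nat -> nat -> bool).
Hypothesis definable_nv : forall d (W : ctx d -> word), input_word W -> definable (fun g => nv (W g)).
Hypothesis definable_nc : forall d (W : ctx d -> word), input_word W -> definable (fun g => nc (W g)).
Hypothesis bdefinable_lit : forall d (W : ctx d -> word) (J L : ctx d -> nat),
  input_word W -> definable J -> definable L -> bdefinable (fun g => lit (W g) (J g) (L g)).

Ltac comp_graph := repeat first
  [ comp_leaf | comp_step | apply definable_div | apply definable_mod
  | apply definable_nv | apply definable_nc | apply bdefinable_lit ].

Lemma definable_order_of d (W : ctx d -> word) : input_word W ->
  definable (fun g => order_of (nv (W g)) (nc (W g))).
Proof. by move=> HW; rewrite /order_of /top; comp_graph. Qed.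

Lemma definable_top d (W : ctx d -> word) : input_word W -> definable (fun g => top (nv (W g)) (nc (W g))).
Proof. by move=> HW; rewrite /top; comp_graph. Qed.

Lemma bdefinable_graph d (W : ctx d -> word) (U V : ctx d -> nat) : input_word W -> definable U -> definable V ->
  bdefinable (fun g => graph (nv (W g)) (nc (W g)) (lit (W g)) (U g) (V g)).
Proof.
move=> HW HU HV; rewrite /graph /item /item_clause /item_lit /order_of /top.
by comp_graph.
Qed.

Lemma wdefinable_edges_into d (W : ctx d -> word) (P : ctx d -> nat -> bool) : input_word W ->
  bdefinable (d := d.+2) (fun g => P g.1.1 (order_of (nv (W g.1.1)) (nc (W g.1.1)) - g.1.2.+1)) ->
  wdefinable (fun g => encode_edges (edges_into (nv (W g)) (nc (W g)) (lit (W g)) (P g))).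
Proof.
move=> HW HP; rewrite /edges_into.
have HO : definable (d := d.+2) (fun g => order_of (nv (W g.1.1)) (nc (W g.1.1)) - g.1.2.+1).
  apply: definable_sub; last by comp_auto.
  exact: (definable_wk (definable_wk (definable_order_of HW))).
apply: wdefinable_edges_for; first exact: definable_order_of.
apply: wdefinable_edges_for; first exact: (definable_wk (definable_order_of HW)).
apply: wdefinable_edges_if => //; last by comp_auto.
apply: bdefinable_and => //.
apply: (bdefinable_graph (W := fun g : ctx d.+2 => W g.1.1)) => //; last by comp_auto.
exact: (input_word_wk (input_word_wk HW)).
Qed.

Lemma wdefinable_item_edges d (W : ctx d -> word) : input_word W ->
  wdefinable (fun g => encode_edges (item_edges (nv (W g)) (nc (W g)) (lit (W g)))).
Proof.
move=> HW; rewrite /item_edges.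
apply: wdefinable_edges_for; first exact: definable_order_of.
have HW1 := input_word_wk HW; have HW3 := input_word_wk (input_word_wk HW1).
apply: (wdefinable_edges_into (W := fun g : ctx d.+1 => W g.1)
  (P := fun g v => top (nv (W g.1)) (nc (W g.1)) < v)) => //.
apply: bdefinable_leq; first exact: definable_succ (definable_top HW3).
by apply: definable_sub; [exact: definable_order_of HW3|comp_auto].
Qed.

Lemma wdefinable_graph_seq d (W : ctx d -> word) : input_word W ->
  wdefinable (fun g => encode_edges (graph_seq (nv (W g)) (nc (W g)) (lit (W g)))).
Proof.
move=> HW; rewrite /graph_seq /phase.
have HW1 := input_word_wk HW; have HW3 := input_word_wk (input_word_wk HW1).
apply: wdefinable_edges_cat; first exact: wdefinable_item_edges.
apply: wdefinable_edges_for; first exact: definable_top.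
have HT := definable_top HW3; have HO := definable_order_of HW3.
apply: wdefinable_edges_cat.
  apply: (wdefinable_edges_into (W := fun g : ctx d.+1 => W g.1)
    (P := fun g v => (v <= top (nv (W g.1)) (nc (W g.1))) && (v != g.2.+1))) => //.
  by comp_auto; done.
apply: wdefinable_edges_cat; first exact: (wdefinable_item_edges HW1).
apply: wdefinable_edges_cat; last exact: (wdefinable_item_edges HW1).
apply: (wdefinable_edges_into (W := fun g : ctx d.+1 => W g.1)
  (P := fun g v => (v <= top (nv (W g.1)) (nc (W g.1))) && (g.2.+1 < top (nv (W g.1)) (nc (W g.1))))) => //.
by comp_auto; done.
Qed.

Lemma wdefinable_graph_encoding d (W : ctx d -> word) : input_word W ->
  wdefinable (fun g => natencode (order_of (nv (W g)) (nc (W g)))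
    (graph (nv (W g)) (nc (W g)) (lit (W g))) 0
    (graph_seq (nv (W g)) (nc (W g)) (lit (W g)))).
Proof.
move=> HW; rewrite /natencode.
have HO := definable_order_of HW.
apply: wdefinable_cat; first exact: wdefinable_encode_nat.
apply: wdefinable_cat; last first.
  by apply: wdefinable_cat; [exact: (wdefinable_encode_nat (definable_const _ 0))|exact: wdefinable_graph_seq].
apply: wdefinable_for => //.
apply: (@wdefinable_ext _ (fun g : ctx d.+1 => flatten [seq [:: graph (nv (W g.1)) (nc (W g.1)) (lit (W g.1)) g.2 v]
  | v <- iota 0 (order_of (nv (W g.1)) (nc (W g.1)))])) => [g|].
  by elim: (iota _ _) => //= v s ->.
apply: wdefinable_for; first exact: (definable_wk HO).
apply: wdefinable_bit; apply: (bdefinable_graph (W := fun g : ctx d.+2 => W g.1.1)); last by comp_auto.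
  exact: (input_word_wk (input_word_wk HW)).
by comp_auto.
Qed.
End GraphEncoding.

Lemma run_later (M : TM) (inputs : seq word) w m n : m <= n ->
  run M m inputs = Some w -> run M n inputs = Some w.
Proof.
rewrite /run => mn; set c := iter m _ _ => H.
have [hc ow] : tm_halt c.1 /\ output c = w by move: H; case: ifP => // _ [].
have -> : iter n (@step M) (init_config M inputs) = c.
  rewrite -(subnK mn) iterD -/c; elim: (n - m) => //= k ->.
  by rewrite /step hc.
by rewrite hc ow.
Qed.

Theorem coNP_hard_validity : coNP_hard relaxation_validity.
Proof.
move=> L [R [q [[M [p HM]] HL]]].
pose Q (x : word) := q.[size x]%R.
(* One running time for all certificates of size at most [Q x]: it exceeds the time of the machine,
   and also [Q x], so that the guessed cells and the one after them lie within the tableau. *)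
pose TT (x : word) := (p.[(size x + Q x)%N]%R + Q x).+1.
pose nv x := nvars M (TT x); pose nc x := nclauses M (TT x).
pose lit x := @tableau_lit M x (Q x) (TT x).
have cQ d (W : ctx d -> word) : input_word W -> definable (fun g => Q (W g)).
  by move=> HW; apply: definable_horner; comp_auto.
have cT d (W : ctx d -> word) : input_word W -> definable (fun g => TT (W g)).
  move=> HW; apply: definable_succ; apply: definable_add; last exact: cQ.
  by apply: definable_horner; apply: definable_add; [comp_auto|exact: cQ].
exists (fun x => natencode (order_of (nv x) (nc x)) (graph (nv x) (nc x) (lit x)) 0
                           (graph_seq (nv x) (nc x) (lit x))); split.
  apply: polytime_function_wdefinable; apply: wdefinable_graph_encoding input_word_fst.
  - by move=> d W /cT HW; rewrite /nv /nvars /width; comp_auto.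
  - by move=> d W /cT HW; rewrite /nc /nclauses /width; comp_auto.
  - by move=> d W J K HW HJ HK; apply: bdefinable_tableau_lit => //; [exact: cQ|exact: cT].
move=> x.
have qT : Q x < TT x by rewrite /TT; lia.
(* The output is the single letter [R x u], so the head of tape 0 stands on that bit, and forbidding
   [false] there expresses acceptance. *)
have Rrun u : size u <= Q x -> R x u = (cell (TT x) ((config_at M x u (TT x)).2 ord0) (TT x) != Some (inl false)).
  move=> uq.
  have le : p.[(size x + size u)%N]%R <= TT x.
    apply: (@leq_trans p.[(size x + Q x)%N]%R); last by rewrite /TT; lia.
    by apply: horner_nat_mono; rewrite leq_add2l.
  have := run_later le (HM x u); rewrite /run -/(config_at M x u (TT x)).
  case: ifP => // _ []; rewrite cell_head /output /tape_read.
  by case: ((config_at _ _ _ _).2 ord0).2 => //= -[[b|]|] //= s [-> _]; case: (R x u).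
have sat : satisfiable (nv x) (nc x) (lit x) <-> exists u, size u <= Q x /\ R x u.
  rewrite tableau_satisfiable; split=> [[val valP]|[u [uq]]].
    exists (guessed_word (Q x) (TT x) val); split; first exact: size_guessed_word.
    rewrite Rrun; last exact: size_guessed_word.
    exact: run_of_holds.
  by rewrite Rrun // => out; exists (@truth_of M x (TT x) u); apply: holds_of_run.
have V := graph_seq_valid (lit x) (nvars_gt0 M (TT x)) (nclauses_gt0 M (TT x)).
have wf := @graph_seq_wf (nv x) (nc x) (lit x) (nvars_gt0 M (TT x)) (nclauses_gt0 M (TT x)).
rewrite (validity_natencode wf).
have NL : ~ L x <-> ~ natvalid (graph (nv x) (nc x) (lit x)) 0 (graph_seq (nv x) (nc x) (lit x)).
  by rewrite HL V sat.
by split=> H; apply: NNPP => N; [apply: (proj2 NL N)|apply: (proj1 NL N)].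
Qed.

Theorem theorem2 : coNP_complete relaxation_validity.
Proof. by split; [exact: coNP_validity | exact: coNP_hard_validity]. Qed.
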